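(* Assume the standing hypotheses of the context and let $\varepsilon\in(0,\varepsilon_0]$. Let $\bar{\boldsymbol\rho}=(\bar\rho_1,\bar\rho_2)\in\mathfrak X_0$ be any global minimizer of $\mathcal E_\varepsilon$ over $\mathcal P_2(\mathbb R^d)^2$. Then there are constants $C_1,C_2>0$ such that on $\mathbb R^d$ \[F_1'(\bar\rho_1)+\varepsilon\partial_{r_1}h(\bar\rho_1,\bar\rho_2)=(C_1-K*\bar\rho_2)_+,\qquad F_2'(\bar\rho_2)+\varepsilon\partial_{r_2}h(\bar\rho_1,\bar\rho_2)=(C_2-K*\bar\rho_1)_+ ,\] and the supports of $\bar\rho_1,\bar\rho_2$ are the compact convex sets \[\mathrm{supp}\,\bar\rho_1=\{K*\bar\rho_2\le C_1\},\qquad \mathrm{supp}\,\bar\rho_2=\{K*\bar\rho_1\le C_2\}.\]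
   Context: Let $d\ge1$. Standing hypotheses. (K): $K:\mathbb R^d\to[0,\infty)$ radially symmetric, $K(0)=0$, $K\in C^2$, $\nabla^2K\ge\lambda\,\mathrm{Id}$ for some $\lambda>0$, $\|\nabla^2K\|\le C_K$. (F): for $j=1,2$, $F_j:[0,\infty)\to[0,\infty)$ is $C^2$, $F_j''>0$ on $(0,\infty)$, $F_j(0)=F_j'(0)=0$, $\liminf_{r\to\infty}F_j''(r)>0$, $\limsup_{r\to\infty}F_j'(r)/F_j(r)<\infty$; there are $m_j,M_j>0,\beta_j\ge0,r_0>0$ with $m_jr^{\beta_j}\le F_j''(r)\le M_jr^{\beta_j}$ on $[0,r_0]$; $F_j(r)-rF_j'(r)+r^2F_j''(r)\ge0$. (h): $h:[0,\infty)^2\to\mathbb R$ is $C^2$, $h$ and $\nabla h$ vanish on $\{r_1=0\}\cup\{r_2=0\}$. ($\theta$): with $\theta_{j,i}(\mathbf u)=\partial_{r_i}\partial_{r_j}h(\mathbf r)/F_i''(r_i)$, $r_k=(F_k')^{-1}(u_k)$, each $\theta_{j,i}$ is locally Lipschitz on $[0,\infty)^2$ and $|\theta_{j,i}(\mathbf u)|\le\kappa_{j,i}\min\{1,u_1,u_2,\sqrt{(F_i')^{-1}(u_i)/(F_j')^{-1}(u_j)}\}$ for constants $\kappa_{j,i}>0$. Notation: $\mathcal P_2(\mathbb R^d)$ probability measures with finite second moment (absolutely continuous ones identified with densities); $\mathfrak m_1[\rho]=\int x\rho$; $\mathfrak X_0=\{\boldsymbol\rho\in\mathcal P_2(\mathbb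 R^d)^2:\mathfrak m_1[\rho_1]+\mathfrak m_1[\rho_2]=0\}$; $\mathcal E_\varepsilon(\boldsymbol\rho)=\int[F_1(\rho_1)+F_2(\rho_2)+\varepsilon h(\rho_1,\rho_2)+\rho_1K*\rho_2]dx$, $=+\infty$ unless both components are absolutely continuous with integrand in $L^1$. $\varepsilon_0>0$ is a number such that $\mathbf r\mapsto F_1(r_1)+F_2(r_2)+2\varepsilon_0h(\mathbf r)$ is convex on $[0,\infty)^2$. *)

(* Defs.v *)
From HB Require Import structures.
From mathcomp Require Import all_boot all_order all_algebra.
From mathcomp Require Import all_classical all_reals all_analysis.
Set Implicit Arguments. Unset Strict Implicit. Unset Printing Implicit Defensive.
Import Order.TTheory GRing.Theory Num.Theory.
Import numFieldNormedType.Exports.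
Local Open Scope classical_set_scope.
Local Open Scope ring_scope.

Definition enorm {R : realType} {n : nat} (x : 'rV[R]_n) : R :=
  Num.sqrt (\sum_(i < n) x ord0 i ^+ 2).

(** Lebesgue integral on R^n of a nonnegative (Borel) function, computed as
    the iterated one-dimensional Lebesgue integral (Tonelli). *)
Fixpoint iint {R : realType} (n : nat) : ('rV[R]_n -> \bar R) -> \bar R :=
  match n return ('rV[R]_n -> \bar R) -> \bar R with
  | O => fun g => g 0
  | S n' => fun g =>
      (\int[@lebesgue_measure R]_t
         iint (fun v : 'rV[R]_n' => g (row_mx (const_mx t : 'rV[R]_1) v)))%E
  end.

Definition borel_set {R : realType} {n : nat} (A : set 'rV[R]_n) : Prop :=
  <<s open >> A.

Definition borel_fun {R : realType} {n : nat} (f : 'rV[R]_n -> R) : Prop :=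
  forall B : set R, measurable B -> borel_set (f @^-1` B).

Definition L1 {R : realType} {n : nat} (f : 'rV[R]_n -> R) : Prop :=
  borel_fun f /\ (iint (fun x => (`|f x|)%:E) < +oo)%E.

(** Integral of a (signed) real function, meaningful when L1 f. *)
Definition Rint {R : realType} {n : nat} (f : 'rV[R]_n -> R) : R :=
  fine (iint (fun x => (Num.max (f x) 0)%:E))
  - fine (iint (fun x => (Num.max (- f x) 0)%:E)).

Definition ae_Rd {R : realType} {n : nat} (P : 'rV[R]_n -> Prop) : Prop :=
  exists N : set 'rV[R]_n, borel_set N /\
    iint (fun x => (\1_N x : R)%:E) = 0%E /\ forall x, ~ N x -> P x.

Definition P2dens {R : realType} {n : nat} (rho : 'rV[R]_n -> R) : Prop :=
  [/\ borel_fun rho, (forall x, 0 <= rho x),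
      iint (fun x => (rho x)%:E) = 1%E &
      (iint (fun x => (enorm x ^+ 2 * rho x)%:E) < +oo)%E].

Definition mom1 {R : realType} {n : nat} (rho : 'rV[R]_n -> R) : 'rV[R]_n :=
  \row_(i < n) Rint (fun x => x ord0 i * rho x).

Definition inX0 {R : realType} {n : nat} (rho1 rho2 : 'rV[R]_n -> R) : Prop :=
  [/\ P2dens rho1, P2dens rho2 & mom1 rho1 + mom1 rho2 = 0].

Definition convol {R : realType} {n : nat} (K rho : 'rV[R]_n -> R) (x : 'rV[R]_n) : R :=
  fine (iint (fun y => (K (x - y) * rho y)%:E)).

Definition energy {R : realType} {n : nat} (K : 'rV[R]_n -> R) (F1 F2 : R -> R)
  (h : R -> R -> R) (eps : R) (rho1 rho2 : 'rV[R]_n -> R) : \bar R :=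
  let f := fun x => F1 (rho1 x) + F2 (rho2 x) + eps * h (rho1 x) (rho2 x)
                    + rho1 x * convol K rho2 x in
  if pselect (L1 f) then (Rint f)%:E else (+oo)%E.

Definition supp_dens {R : realType} {n : nat} (rho : 'rV[R]_n -> R) : set 'rV[R]_n :=
  [set x | forall r : R, 0 < r ->
     (0 < iint (fun y => (rho y * \1_[set z | enorm (z - x) < r] y)%:E))%E].

Definition convex_set_rV {R : realType} {n : nat} (A : set 'rV[R]_n) : Prop :=
  forall x y, A x -> A y -> forall t : R, 0 <= t <= 1 -> A (t *: x + (1 - t) *: y).

Definition Khyp {R : realType} {n : nat} (K : 'rV[R]_n -> R) : Prop :=
  [/\ (forall x, 0 <= K x), K 0 = 0,
      (forall x y, enorm x = enorm y -> K x = K y),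
      (* K is C^2: all first and second directional derivatives exist, and the
         second ones are continuous *)
      [/\ (forall x v, derivable K x v),
          (forall x v w, derivable ('D_w K) x v) &
          (forall v w, continuous ('D_v ('D_w K)))] &
      exists lam CK : R, [/\ 0 < lam,
        (forall x v, lam * enorm v ^+ 2 <= 'D_v ('D_v K) x) &
        (forall x v w, `|'D_v ('D_w K) x| <= CK * enorm v * enorm w)]].

(** F is C^2 on [0,oo) with derivatives dF, d2F (one-sided at 0). *)
Definition C2_half {R : realType} (F dF d2F : R -> R) : Prop :=
  [/\ (forall r : R, 0 < r -> is_derive r 1 F (dF r) /\ is_derive r 1 dF (d2F r)),
      {within [set r | 0 <= r], continuous F},
      {within [set r | 0 <= r], continuous dF} &
      {within [set r | 0 <= r], continuous d2F}].

Definition Fhyp {R : realType} (F dF d2F : R -> R) : Prop :=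
  [/\ C2_half F dF d2F,
      (forall r, 0 <= r -> 0 <= F r),
      (forall r, 0 < r -> 0 < d2F r),
      F 0 = 0 /\ dF 0 = 0 &
      [/\ (* liminf_{r->oo} F''(r) > 0 *)
      (exists c M : R, 0 < c /\ forall r, M < r -> c <= d2F r),
      (* limsup_{r->oo} F'(r)/F(r) < oo *)
      (exists C M : R, forall r, M < r -> dF r / F r <= C),
      (exists m M beta r0 : R, [/\ 0 < m, 0 < M, 0 <= beta, 0 < r0 &
         forall r, 0 <= r <= r0 -> m * powR r beta <= d2F r <= M * powR r beta]) &
      (forall r, 0 <= r -> 0 <= F r - r * dF r + r ^+ 2 * d2F r)]].

Definition quadrant {R : realType} : set (R * R) := [set p | 0 <= p.1 /\ 0 <= p.2].

(** Hypothesis (h): h is C^2 on [0,oo)^2, with first partials h1 = d_{r1} h,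
    h2 = d_{r2} h and second partials hj_i = d_{r_i} d_{r_j} h. *)
Definition hhyp {R : realType} (h h1 h2 h1_1 h1_2 h2_1 h2_2 : R -> R -> R) : Prop :=
  [/\ (forall r1 r2 : R, 0 < r1 -> 0 < r2 ->
        [/\ is_derive r1 1 (fun s => h s r2) (h1 r1 r2),
            is_derive r2 1 (fun s => h r1 s) (h2 r1 r2) &
          [/\ is_derive r1 1 (fun s => h1 s r2) (h1_1 r1 r2),
            is_derive r2 1 (fun s => h1 r1 s) (h1_2 r1 r2),
            is_derive r1 1 (fun s => h2 s r2) (h2_1 r1 r2) &
            is_derive r2 1 (fun s => h2 r1 s) (h2_2 r1 r2)]]),
      (forall g, g \in [:: h; h1; h2; h1_1; h1_2; h2_1; h2_2] ->
         {within quadrant, continuous (fun p : R * R => g p.1 p.2)}) &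
      (forall r1 r2, 0 <= r1 -> 0 <= r2 -> (r1 = 0 \/ r2 = 0) ->
         [/\ h r1 r2 = 0, h1 r1 r2 = 0 & h2 r1 r2 = 0])].

Definition locLip_quadrant {R : realType} (th : R -> R -> R) : Prop :=
  forall M : R, exists L : R, forall u1 u2 v1 v2,
    0 <= u1 <= M -> 0 <= u2 <= M -> 0 <= v1 <= M -> 0 <= v2 <= M ->
    `|th u1 u2 - th v1 v2| <= L * (`|u1 - v1| + `|u2 - v2|).

Definition pick {R : realType} (k : nat) (r1 r2 : R) : R :=
  if k == 1%N then r1 else r2.

(** Hypothesis on theta_{j,i}(u) = d_{r_i} d_{r_j} h (r) / F_i''(r_i),
    r_k = (F_k')^{-1}(u_k); hji = d_{r_i} d_{r_j} h, d2Fi = F_i''. *)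
Definition theta_ok {R : realType} (j i : nat) (dF1 dF2 d2Fi : R -> R)
  (hji : R -> R -> R) : Prop :=
  exists (th : R -> R -> R) (kappa : R), [/\ 0 < kappa, locLip_quadrant th &
    forall r1 r2, 0 <= r1 -> 0 <= r2 ->
      let u1 := dF1 r1 in let u2 := dF2 r2 in
      (d2Fi (pick i r1 r2) != 0 -> th u1 u2 = hji r1 r2 / d2Fi (pick i r1 r2)) /\
      `|th u1 u2| <= kappa * Num.min 1 (Num.min u1 (Num.min u2
                       (Num.sqrt (pick i r1 r2 / pick j r1 r2))))].

Definition convex_quadrant {R : realType} (G : R -> R -> R) : Prop :=
  forall r1 r2 s1 s2 t : R, 0 <= r1 -> 0 <= r2 -> 0 <= s1 -> 0 <= s2 -> 0 <= t <= 1 ->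
    G (t * r1 + (1 - t) * s1) (t * r2 + (1 - t) * s2)
      <= t * G r1 r2 + (1 - t) * G s1 s2.

(* Main.v *)
Require Import Defs.
From HB Require Import structures.
From mathcomp Require Import all_boot all_order all_algebra.
From mathcomp Require Import all_classical all_reals all_analysis.
From mathcomp Require Import measurable_realfun ring lra.
Set Implicit Arguments. Unset Strict Implicit. Unset Printing Implicit Defensive.
Import Order.TTheory GRing.Theory Num.Theory.
Import numFieldNormedType.Exports.
Local Open Scope classical_set_scope.
Local Open Scope ring_scope.

(** For fixed second component, the energy is convex in the first one, so it
    suffices to compare with one-component perturbations.  Let
    [g = F1'(rho1) + eps * d1 h(rho1, rho2) + K * rho2] be the marginal cost of
    mass at a point.  If [g < a] on a set of positive measure and [g > b > a] on a
    set of positive measure where [rho1 > 0], moving a little mass from the second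
    set to the first lowers the energy; since all integrands are nonnegative, the
    slope inequalities of convex functions give this without differentiating under
    the integral.  Hence [g >= C1] a.e., with equality where [rho1 > 0].  As
    [eps <= eps0], the integrand minus half of [F1 + F2] is still convex, so the
    partial derivative of the integrand is positive exactly where [rho1 > 0]; thus
    [{rho1 > 0}] is a.e. the open sublevel set [{K * rho2 < C1}] of a convex,
    continuous, coercive function, and its closure is the compact convex set
    [{K * rho2 <= C1}].  The second equation follows by exchanging the two
    components, the interaction being symmetric by Tonelli. *)

(** * Lebesgue measure on row vectors *)

(** With this sigma-algebra, generated by the open sets, [measurable] on row vectors is by
    definition [borel_set]. *)
HB.instance Definition _ (R : realType) (n : nat) :=
  Measurable.copy 'rV[R]_n (g_sigma_algebraType (@open 'rV[R]_n)).

Section BorelRowVectors.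
Context {R : realType}.

Lemma open_measurable_rV n (A : set 'rV[R]_n) : open A -> measurable A.
Proof. exact: sub_sigma_algebra. Qed.

Lemma continuous_measurable_rV n (f : 'rV[R]_n -> R) :
  continuous f -> measurable_fun setT f.
Proof.
move=> /continuousP cf; apply: (measurability _ (RGenOpens.measurableE R)).
move=> _ [_ [a [b ->] <-]]; rewrite setTI; apply: open_measurable_rV.
exact/cf/interval_open.
Qed.

Lemma measurable_coord n (i : 'I_n) :
  measurable_fun setT (fun x : 'rV[R]_n => x ord0 i).
Proof. by apply: continuous_measurable_rV; exact: coord_continuous. Qed.

(** A countable basis of balls with rational centres. Balls of the sup norm are products of
    intervals, so this reduces measurability of a map into row vectors to that of its
    coordinates. *)
Lemma rat_ball_basis n (A : set 'rV[R]_n) : open A ->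
  A = \bigcup_(p : 'rV[rat]_n * nat)
    [set y | ball (map_mx (@ratr R) p.1) p.2.+1%:R^-1 y /\
             ball (map_mx (@ratr R) p.1) p.2.+1%:R^-1 `<=` A].
Proof.
move=> oA; apply/seteqP; split=> [x Ax|x [p _ [px pA]]]; last exact: pA.
have /nbhs_ballP[e /= e0 eA] : nbhs x A by exact: open_nbhs_nbhs.
have [k ke] : exists k, k.+1%:R^-1 < e / 2.
  have /cvgrPdist_lt/(_ (e / 2)) := @cvg_harmonic R.
  have -> : 0 < e / 2 by rewrite divr_gt0.
  move=> /(_ isT)[k _ /(_ k (leqnn k))]; rewrite /= sub0r normrN ger0_norm// => ?.
  by exists k.
have H (i : 'I_n) : exists q : rat, ball (x ord0 i) k.+1%:R^-1 (ratr q : R).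
  have [] := @dense_rat R (ball (x ord0 i) k.+1%:R^-1).
  - exists (x ord0 i); exact: ballxx.
  - exact: ball_open.
  - by move=> y [By [q _ qy]]; exists q; rewrite qy.
have [q qx] := choice H.
exists (\row_i q i, k) => //=.
have xq : ball (map_mx (@ratr R) (\row_i q i)) k.+1%:R^-1 x.
  split => // i j; rewrite !mxE; apply: ball_sym; rewrite (ord1 i); exact: qx.
split => // y qy; apply: eA.
have -> : e = e / 2 + e / 2 by rewrite -splitr.
apply: ball_triangle; [apply: (le_ball (ltW ke)); exact: ball_sym xq|].
exact: (le_ball (ltW ke)).
Qed.

Lemma measurable_fun_rV d (T : measurableType d) n (f : T -> 'rV[R]_n) :
  (forall i, measurable_fun setT (fun x => f x ord0 i)) -> measurable_fun setT f.
Proof.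
move=> mf; apply: (@measurability _ _ T 'rV[R]_n setT f (@open 'rV[R]_n)) => //.
move=> _ [A oA <-]; rewrite setTI (rat_ball_basis oA) preimage_bigcup.
apply: countable_bigcupT_measurable => // p.
have [pA|pA] := pselect (ball (map_mx (@ratr R) p.1) p.2.+1%:R^-1 `<=` A); last first.
  by rewrite (_ : _ @^-1` _ = set0)//; apply/seteqP; split=> // x [].
rewrite (_ : _ @^-1` _ = \big[setI/setT]_(i < n)
   ((fun x => f x ord0 i) @^-1` ball (ratr (p.1 ord0 i) : R) p.2.+1%:R^-1)).
  apply: bigsetI_measurable => i _; rewrite -[X in measurable X]setTI.
  by apply: mf => //; exact: measurable_ball.
apply/seteqP; split=> x.
  move=> [[_ px] _]; rewrite -bigcap_seq => i _ /=.
  by have := px ord0 i; rewrite mxE.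
rewrite -bigcap_seq => px; split => //; split => // i j; rewrite mxE (ord1 i).
by apply: (px j); rewrite /= mem_index_enum.
Qed.

Lemma measurable_row_mx n :
  measurable_fun setT (fun p : R * 'rV[R]_n => row_mx (const_mx p.1 : 'rV[R]_1) p.2).
Proof.
apply: measurable_fun_rV => i.
case: (split_ordP i) => j ->.
- rewrite [X in measurable_fun _ X](_ : _ = fst); first exact: measurable_fst.
  by apply/funext => p; rewrite row_mxEl mxE.
- rewrite [X in measurable_fun _ X](_ : _ = (fun x : 'rV[R]_n => x ord0 j) \o snd).
    by apply: measurableT_comp; [exact: measurable_coord|exact: measurable_snd].
  by apply/funext => p; rewrite row_mxEr.
Qed.
End BorelRowVectors.

Section LebesgueRowVectors.
Context {R : realType}.
Local Open Scope ereal_scope.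

Lemma row_mx_cons0 n (t : R) (v : 'rV[R]_n) :
  (row_mx (const_mx t : 'rV[R]_1) v : 'rV[R]_n.+1) ord0 ord0 = t.
Proof. by rewrite mxE; case: splitP => [j _|j]; rewrite ?mxE. Qed.

Lemma row_mx_consS n (t : R) (v : 'rV[R]_n) k :
  (row_mx (const_mx t : 'rV[R]_1) v : 'rV[R]_n.+1) ord0 (lift ord0 k) = v ord0 k.
Proof.
rewrite mxE; case: splitP => [j|j]; first by rewrite (ord1 j).
by rewrite lift0 add1n => -[/val_inj ->].
Qed.

Lemma ball_row_mx n (x : 'rV[R]_n.+1) r :
  (fun p : R * 'rV[R]_n => row_mx (const_mx p.1 : 'rV[R]_1) p.2) @^-1` ball x r =
  ball (x ord0 ord0) r `*` ball (\row_i x ord0 (lift ord0 i)) r.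
Proof.
apply/seteqP; split=> -[t v] /=.
  move=> [r0 xp]; split => /=; first by have := xp ord0 ord0; rewrite row_mx_cons0.
  split=> // i j; rewrite (ord1 i) mxE; have := xp ord0 (lift ord0 j).
  by rewrite row_mx_consS.
move=> [xt [r0 xv]]; split => // i j; rewrite (ord1 i).
case: (unliftP ord0 j) => [k|] ->; last by rewrite row_mx_cons0.
by rewrite row_mx_consS; have := xv ord0 k; rewrite mxE.
Qed.

(** Induction on the dimension: the new measure is the image of (Lebesgue measure on the line) x
    [mu] under prepending a coordinate, and Tonelli turns its integral into the iterated one. The
    volume of balls, which are cubes of side [2 * r], is carried along because it yields
    sigma-finiteness at the next stage. *)
Lemma lebesgue_rV_exists n : { mu : {sigma_finite_measure set 'rV[R]_n -> \bar R} |
  (forall g : 'rV[R]_n -> \bar R, measurable_fun setT g -> (forall x, 0 <= g x) ->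
     iint g = \int[mu]_x g x) /\
  (forall x r, (0 < r)%R -> mu (ball x r) = ((2 * r) ^+ n)%:E) }.
Proof.
elim: n => [|n [mu [muE muB]]].
  exists (dirac (0%R : 'rV[R]_0)); split.
    by move=> g mg g0; rewrite integral_dirac//= diracT mul1e.
  move=> x r r0; rewrite /= expr0 /dirac indicE mem_set//.
  by rewrite (_ : (0%R : 'rV[R]_0) = x) ; [exact: ballxx|apply/rowP; case].
pose f := fun p : measurableTypeR R * 'rV[R]_n => row_mx (const_mx p.1 : 'rV[R]_1) p.2.
have mf : measurable_fun setT f by exact: measurable_row_mx.
pose nu := (@lebesgue_measure R \x mu)%E.
pose m : {measure set 'rV[R]_n.+1 -> \bar R} :=
  measure_function_pushforward__canonical__measure_function_Measure nu mf.
have mB x r : (0 < r)%R -> m (ball x r) = ((2 * r) ^+ n.+1)%:E.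
  move=> r0; rewrite [m _]/(nu (f @^-1` ball x r)) ball_row_mx /nu product_measure1E.
  - rewrite muB// exprS EFinM; congr (_ * _).
    by rewrite mulr_natl; exact: lebesgue_measure_ball (ltW r0).
  - exact: measurable_ball.
  - by apply: open_measurable_rV; exact: ball_open.
have sf : sigma_finite setT m.
  exists (fun k => ball 0%R k.+1%:R).
    apply/seteqP; split=> // x _.
    exists (Num.truncn `|x|) => //; rewrite -ball_normE /= sub0r normrN.
    exact: truncnS_gt.
  move=> k; split; last by rewrite mB// ltry.
  by apply: open_measurable_rV; exact: ball_open.
pose sm : {sigma_finite_measure set 'rV[R]_n.+1 -> \bar R} :=
  HB.pack (m : set _ -> \bar R) (Measure.class m) (Measure_isSigmaFinite.Build _ _ _ m sf).
exists sm.
split => [g mg g0|x r r0]; last exact: mB.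
rewrite [RHS](_ : _ = \int[nu]_p g (f p)); last first.
  by rewrite (@ge0_integral_pushforward _ _ _ _ _ f mf nu setT)// => x _.
have mgf : measurable_fun setT (g \o f) by exact: measurableT_comp.
have gf0 p : 0 <= (g \o f) p by exact: g0.
rewrite /nu (@fubini_tonelli1 _ _ _ _ _ _ _ (g \o f))//.
apply: eq_integral => t _; apply: muE => //.
exact: (measurableT_comp mgf (pair1_measurable t)).
Qed.

Definition leb n : {sigma_finite_measure set 'rV[R]_n -> \bar R} :=
  sval (lebesgue_rV_exists n).

Lemma iintE n (g : 'rV[R]_n -> \bar R) : measurable_fun setT g ->
  (forall x, 0 <= g x) -> iint g = \int[leb n]_x g x.
Proof. exact: (svalP (lebesgue_rV_exists n)).1. Qed.

Lemma leb_ball n (x : 'rV[R]_n) r : (0 < r)%R -> leb n (ball x r) = ((2 * r) ^+ n)%:E.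
Proof. exact: (svalP (lebesgue_rV_exists n)).2. Qed.

Lemma measurable_ball_rV n (x : 'rV[R]_n) r : measurable (ball x r).
Proof. by apply: open_measurable_rV; exact: ball_open. Qed.

Lemma leb_open_gt0 n (A : set 'rV[R]_n) : open A -> A !=set0 -> 0 < leb n A.
Proof.
move=> oA [x Ax]; have /nbhs_ballP[r /= r0 rA] : nbhs x A by exact: open_nbhs_nbhs.
apply: (@lt_le_trans _ _ (leb n (ball x r))).
  by rewrite leb_ball// lte_fin exprn_gt0// mulr_gt0.
by apply: le_measure => //; rewrite inE;
  [exact: measurable_ball_rV|exact: open_measurable_rV].
Qed.

Lemma iint_indic n (A : set 'rV[R]_n) : measurable A ->
  iint (fun x => (\1_A x : R)%:E) = leb n A.
Proof.
move=> mA; rewrite iintE; first by rewrite integral_indic// setIT.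
- exact/measurable_EFinP/measurable_indic.
- by move=> x; rewrite lee_fin.
Qed.

End LebesgueRowVectors.

(** * Nonnegative integrals and the squared norm *)

Section NonnegRealIntegral.
Context d (T : measurableType d) (R : realType) (mu : {measure set T -> \bar R}).
Implicit Types f g : T -> R.
Local Open Scope ereal_scope.

Lemma nnintD f g : measurable_fun setT f -> measurable_fun setT g ->
  (forall x, 0 <= f x)%R -> (forall x, 0 <= g x)%R ->
  \int[mu]_x (f x + g x)%:E = \int[mu]_x (f x)%:E + \int[mu]_x (g x)%:E.
Proof.
move=> mf mg f0 g0; under eq_integral do rewrite EFinD.
by rewrite ge0_integralD//; try exact/measurable_EFinP; move=> x _; rewrite lee_fin.
Qed.

Lemma nnintZ k f : measurable_fun setT f -> (forall x, 0 <= f x)%R -> (0 <= k)%R ->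
  \int[mu]_x (k * f x)%:E = k%:E * \int[mu]_x (f x)%:E.
Proof.
move=> mf f0 k0; under eq_integral do rewrite EFinM.
by rewrite ge0_integralZl_EFin//; try exact/measurable_EFinP; move=> x _; rewrite lee_fin.
Qed.

Lemma nnint_le f g : measurable_fun setT f -> measurable_fun setT g ->
  (forall x, 0 <= f x)%R -> (forall x, f x <= g x)%R ->
  \int[mu]_x (f x)%:E <= \int[mu]_x (g x)%:E.
Proof.
move=> mf mg f0 fg.
by apply: ge0_le_integral => //; try exact/measurable_EFinP; move=> x _; rewrite lee_fin.
Qed.

Lemma nnint_ge0 f : (forall x, 0 <= f x)%R -> 0 <= \int[mu]_x (f x)%:E.
Proof. by move=> f0; apply: integral_ge0 => x _; rewrite lee_fin. Qed.

End NonnegRealIntegral.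

Section RealContinuous.
Context {R : realType} {T : topologicalType}.
Implicit Types f g : T -> R.

Lemma continuous_add f g :
  continuous f -> continuous g -> continuous (fun x => f x + g x).
Proof. by move=> cf cg x; apply: (@cvgD _ _ _ (nbhs x)); [exact: cf|exact: cg]. Qed.

Lemma continuous_mul f g :
  continuous f -> continuous g -> continuous (fun x => f x * g x).
Proof. by move=> cf cg x; apply: (@cvgM _ _ (nbhs x)); [exact: cf|exact: cg]. Qed.

End RealContinuous.

Section SquaredNorm.
Context {R : realType} {n : nat}.
Implicit Types x y z : 'rV[R]_n.

Definition sqn x : R := \sum_(i < n) x ord0 i ^+ 2.

Lemma sqn_ge0 x : 0 <= sqn x.
Proof. by apply: sumr_ge0 => i _; exact: sqr_ge0. Qed.

Lemma enorm_sqr x : enorm x ^+ 2 = sqn x.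
Proof. by rewrite sqr_sqrtr// sqn_ge0. Qed.

Lemma enorm_ge0 x : 0 <= enorm x.
Proof. exact: sqrtr_ge0. Qed.

Lemma sqnZ k x : sqn (k *: x) = k ^+ 2 * sqn x.
Proof. by rewrite /sqn mulr_sumr; apply: eq_bigr => i _; rewrite mxE exprMn. Qed.

Lemma enormZ k x : 0 <= k -> enorm (k *: x) = k * enorm x.
Proof.
move=> k0; rewrite /enorm -/(sqn _) sqnZ sqrtrM ?sqr_ge0// sqrtr_sqr ger0_norm//.
Qed.

Lemma sqnN x : sqn (- x) = sqn x.
Proof. by rewrite -scaleN1r sqnZ sqrrN expr1n mul1r. Qed.

Lemma enormN x : enorm (- x) = enorm x.
Proof. by rewrite /enorm -!/(sqn _) sqnN. Qed.

Lemma sqnD_le x y : sqn (x + y) <= 2 * sqn x + 2 * sqn y.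
Proof.
rewrite /sqn !mulr_sumr -big_split/=; apply: ler_sum => i _; rewrite mxE.
have := sqr_ge0 (x ord0 i - y ord0 i); nra.
Qed.

Lemma continuous_sqn : continuous sqn.
Proof.
suff c (s : seq 'I_n) : continuous (fun x : 'rV[R]_n => \sum_(i <- s) x ord0 i ^+ 2).
  exact: c.
elim: s => [|i s IH].
  rewrite (_ : (fun _ => _) = cst 0); first exact: cst_continuous.
  by apply/funext => y; rewrite big_nil.
rewrite (_ : (fun _ => _) = (fun y : 'rV[R]_n => y ord0 i * y ord0 i +
    \sum_(j <- s) y ord0 j ^+ 2)); last by apply/funext => y; rewrite big_cons expr2.
by apply: continuous_add => //; apply: continuous_mul; exact: coord_continuous.
Qed.

Lemma measurable_sqn : measurable_fun setT sqn.
Proof. by apply: continuous_measurable_rV; exact: continuous_sqn. Qed.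

Lemma continuous_enorm : continuous (@enorm R n).
Proof.
move=> x; apply: (continuous_comp (@continuous_sqn x)); exact: sqrt_continuous.
Qed.

Lemma enorm_ball_open x r : open [set z | enorm (z - x) < r].
Proof.
have c : continuous (fun z => enorm (z - x)).
  move=> z; apply: (continuous_comp (f := fun z => z - x)); last exact: continuous_enorm.
  by apply: (@cvgB _ _ _ (nbhs z)); [exact: cvg_id|exact: cvg_cst].
by move/continuousP: c => /(_ _ (@open_lt R r)).
Qed.

Lemma sqn_ball_le x y r : 0 <= r -> ball x r y ->
  sqn y <= \sum_(i < n) (`|x ord0 i| + r) ^+ 2.
Proof.
move=> r0 [_ xy]; apply: ler_sum => i _; have := xy ord0 i.
rewrite -ball_normE /= => xyi.
rewrite -[leLHS]real_normK ?num_real// ler_pXn2r ?nnegrE ?addr_ge0//.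
rewrite (_ : y ord0 i = x ord0 i - (x ord0 i - y ord0 i)); last by ring.
by apply: (le_trans (ler_normB _ _)); rewrite lerD2l ltW.
Qed.

Lemma norm_le_sqn x : `|x| ^+ 2 <= sqn x.
Proof.
rewrite -[leRHS]sqr_sqrtr ?sqn_ge0// ler_pXn2r ?nnegrE ?sqrtr_ge0//.
rewrite [leLHS]/Num.norm/= mx_normrE; apply/bigmax_leP; split; first exact: sqrtr_ge0.
move=> [i j] _ /=; rewrite (ord1 i) -sqrtr_sqr; apply: ler_wsqrtr.
by rewrite /sqn (bigD1 j)//= lerDl sumr_ge0// => k _; exact: sqr_ge0.
Qed.

Definition convex_fun (f : 'rV[R]_n -> R) := forall x y t, 0 <= t <= 1 ->
  f (t *: x + (1 - t) *: y) <= t * f x + (1 - t) * f y.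

(** A convex function that is nonnegative and locally bounded satisfies a local Lipschitz estimate.
    Continuity of the kernel and of its convolutions comes from here, without any limit under the
    integral. *)
Lemma convex_continuous (f : 'rV[R]_n -> R) a b : 0 <= a -> 0 <= b ->
  convex_fun f -> (forall x, 0 <= f x <= a * sqn x + b) -> continuous f.
Proof.
move=> a0 b0 cf fb z.
pose B := a * (\sum_(i < n) (`|z ord0 i| + 3) ^+ 2) + b.
have B0 : 0 <= B by rewrite addr_ge0// mulr_ge0// sumr_ge0// => i _; exact: sqr_ge0.
have fB w : ball z 3 w -> f w <= B.
  move=> zw; have /andP[_ /le_trans] := fb w; apply.
  by rewrite lerD2r ler_wpM2l// sqn_ball_le.
have step x y : `|z - x| < 1 -> `|z - y| < 1 -> 0 < `|y - x| -> `|y - x| <= 1 ->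
    f y - f x <= `|y - x| * B.
  move=> zx zy s0 s1; set s := `|y - x| in s0 s1 *.
  (* [w] lies at unit distance from [x] on the ray through [y], hence within 3 of [z]. As [y] is a
     convex combination of [w] and [x], the increment of [f] is at most [s * f w]. *)
  pose w := x + s^-1 *: (y - x).
  have -> : y = s *: w + (1 - s) *: x.
    apply/rowP => i; rewrite !mxE; field; exact: lt0r_neq0.
  have zw : ball z 3 w.
    rewrite -ball_normE /= /w opprD addrA; apply: (le_lt_trans (ler_normB _ _)).
    rewrite normrZ ger0_norm ?invr_ge0 ?ltW// mulVf ?lt0r_neq0//.
    by apply: (@lt_le_trans _ _ (1 + 1)); [rewrite ltrD2r|lra].
  have := cf w x s; rewrite (ltW s0) s1 => /(_ isT).
  have := fB _ zw; have /andP[fx0 _] := fb x; nra.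
have lip x : `|z - x| < 1 -> `|f z - f x| <= `|z - x| * B.
  move=> zx1; have [->|zx] := eqVneq z x; first by rewrite !subrr !normr0 mul0r.
  have zx0 : 0 < `|z - x| by rewrite normr_gt0 subr_eq0.
  have zz : `|z - z| < 1 by rewrite subrr normr0.
  rewrite ler_norml lerNl opprB; apply/andP; split.
    by rewrite distrC; apply: step => //; rewrite distrC//; exact: ltW.
  by apply: step => //; exact: ltW.
apply/(@cvgrPdist_lt _ _ _ (nbhs z)) => e e0; apply/nbhs_ballP.
exists (Num.min 1 (e / (B + 1))).
  by rewrite /= lt_min ltr01 divr_gt0// ltr_wpDl.
move=> x; rewrite -ball_normE /= lt_min => /andP[zx1 zxe].
apply: (le_lt_trans (lip _ zx1)); apply: (@le_lt_trans _ _ (`|z - x| * (B + 1))).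
  by rewrite ler_wpM2l// lerDl.
by rewrite -ltr_pdivlMr// ltr_wpDl.
Qed.
End SquaredNorm.

(** * The kernel *)

Section SecondOrder.
Context {R : realType}.

Lemma tangent_line_le (f f1 f2 : R -> R) a b :
  (forall t : R, is_derive t 1 f (f1 t)) -> (forall t : R, is_derive t 1 f1 (f2 t)) ->
  (forall t, 0 <= f2 t) -> f a + f1 a * (b - a) <= f b.
Proof.
move=> df df1 f20.
have cont (g g1 : R -> R) c e : (forall t : R, is_derive t 1 g (g1 t)) ->
    {within `[c, e], continuous g}.
  move=> dg; apply: continuous_subspaceT => t.
  by apply/differentiable_continuous/derivable1_diffP; exact: ex_derive.
have mono c e : c <= e -> f1 c <= f1 e.
  rewrite le_eqVlt => /predU1P[->//|ce].
  have [t _] := MVT ce (fun t _ => df1 t) (cont _ _ c e df1).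
  by have := f20 t; nra.
have [ab|ba|->] := ltgtP a b; last by lra.
- have [t /andP[/= at_ _] H] := MVT ab (fun t _ => df t) (cont _ _ a b df).
  have := mono a t; rewrite bnd_simp in at_; rewrite (ltW at_) => /(_ isT); nra.
- have [t /andP[/= _ ta] H] := MVT ba (fun t _ => df t) (cont _ _ b a df).
  have := mono t a; rewrite bnd_simp in ta; rewrite (ltW ta) => /(_ isT); nra.
Qed.

(** Subtracting the parabola [m / 2 * t ^+ 2] leaves a function with nonnegative second derivative,
    which lies above its tangent at 0. *)
Lemma taylor2_ge (f f1 f2 : R -> R) m b :
  (forall t : R, is_derive t 1 f (f1 t)) -> (forall t : R, is_derive t 1 f1 (f2 t)) ->
  (forall t, m <= f2 t) -> f 0 + f1 0 * b + m / 2 * b ^+ 2 <= f b.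
Proof.
move=> df df1 mf2.
have dmul k (t : R) : is_derive t 1 (fun s => k * s) k.
  have H := is_deriveM (is_derive_cst k t 1) (is_derive_id t 1).
  by apply: (is_derive_eq H); rewrite /GRing.scale/=; ring.
have dsqr (t : R) : is_derive t 1 (fun s => m / 2 * s * s) (m * t).
  have H := is_deriveM (dmul (m / 2) t) (is_derive_id t 1).
  by apply: (is_derive_eq H); rewrite /GRing.scale/=; field.
have d1 (t : R) : is_derive t 1 (fun s => f s - m / 2 * s * s) (f1 t - m * t).
  exact: is_deriveB.
have d2 (t : R) : is_derive t 1 (fun s => f1 s - m * s) (f2 t - m).
  exact: is_deriveB.
have := @tangent_line_le _ _ _ 0 b d1 d2; rewrite subr0.
move=> H; have : forall t, 0 <= f2 t - m by move=> t; rewrite subr_ge0.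
by move=> /H; lra.
Qed.

Lemma is_derive_line n (f : 'rV[R]_n -> R) x v (t : R) : derivable f (x + t *: v) v ->
  is_derive t 1 (fun s => f (x + s *: v)) ('D_v f (x + t *: v)).
Proof.
move=> fv.
have E : (fun h : R => h^-1 *: (((fun s => f (x + s *: v)) \o shift t) (h *: 1) - f (x + t *: v))) =
    (fun h => h^-1 *: ((f \o shift (x + t *: v)) (h *: v) - f (x + t *: v))).
  apply/funext => h /=; congr (_ *: (f _ - _)).
  have -> : h *: (1 : R) = h by exact: mulr1.
  by rewrite scalerDl addrCA.
by split; [rewrite /derivable E|rewrite /derive E].
Qed.

End SecondOrder.

(** From here on the kernel enters only through evenness, convexity and a two-sided quadratic
    bound. *)
Lemma Khyp_bounds {R : realType} n (K : 'rV[R]_n -> R) : Khyp K ->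
  [/\ forall x, 0 <= K x, forall x, K (- x) = K x, convex_fun K &
      exists a c, [/\ 0 < a, 0 <= c & forall x, a * sqn x <= K x <= c * sqn x]].
Proof.
move=> [K0 K00 Krad [K1 K2 _] [lam [CK [lam0 Hlo Hup]]]].
have sym x : K (- x) = K x by apply: Krad; rewrite enormN.
have d1 x v (t : R) : is_derive t 1 (fun s => K (x + s *: v)) ('D_v K (x + t *: v)).
  exact: is_derive_line.
have d2 x v (t : R) : is_derive t 1 (fun s => 'D_v K (x + s *: v)) ('D_v ('D_v K) (x + t *: v)).
  exact: is_derive_line.
have convK x y t : 0 <= t <= 1 -> K (t *: x + (1 - t) *: y) <= t * K x + (1 - t) * K y.
  move=> /andP[t0 t1]; pose v := x - y.
  have pos s : 0 <= 'D_v ('D_v K) (y + s *: v).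
    by apply: le_trans (Hlo _ _); rewrite mulr_ge0 ?sqr_ge0// ltW.
  (* Convexity on a segment: the tangent at the intermediate point lies below [K] at both ends, and
     the weighted sum removes the slope. *)
  have T b := tangent_line_le t b (d1 y v) (d2 y v) pos.
  have := T 0; have := T 1; rewrite scale0r scale1r addr0.
  have -> : y + v = x by rewrite /v addrC subrK.
  have -> : y + t *: v = t *: x + (1 - t) *: y by apply/rowP => i; rewrite !mxE; ring.
  move: (K _) (K _) (K _) ('D_v K _) => k1 k2 k3 k4; nra.
split => //; exists (lam / 2), (`|CK| / 2); split; first by rewrite divr_gt0.
  by rewrite divr_ge0.
move=> x.
have lo s : lam * sqn x <= 'D_x ('D_x K) (0 + s *: x) by rewrite -enorm_sqr.
(* The upper bound is the lower Taylor bound for [- K]. The sign of [CK] is not prescribed, hence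
   the absolute value. *)
have up s : - (`|CK| * sqn x) <= - 'D_x ('D_x K) (0 + s *: x).
  rewrite lerN2; apply: (le_trans (ler_norm _)); apply: (le_trans (Hup _ _ _)).
  by rewrite -mulrA -expr2 enorm_sqr ler_wpM2r ?sqn_ge0// ler_norm.
have L b := taylor2_ge b (d1 0 x) (d2 0 x) lo.
have U b : - K (0 + 0 *: x) + - 'D_x K (0 + 0 *: x) * b +
    - (`|CK| * sqn x) / 2 * b ^+ 2 <= - K (0 + b *: x) :=
  taylor2_ge b (fun t => is_deriveN (d1 0 x t)) (fun t => is_deriveN (d2 0 x t)) up.
(* [K] is even and vanishes at 0, so averaging the bounds at 1 and -1 cancels the first-order
   term. *)
have := L 1; have := L (-1); have := U 1; have := U (-1).
rewrite /= !add0r !scale0r !scaleN1r !scale1r sym K00 sqrrN expr1n.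
move: (K x) ('D_x K 0) (sqn x) => k1 k2 k3 A B C D.
apply/andP; split; lra.
Qed.

(** * Convolutions with the kernel *)

Section Densities.
Context {R : realType} {n : nat}.
Implicit Types (x y : 'rV[R]_n) (f rho : 'rV[R]_n -> R).
Local Notation mu := (@leb R n).

Lemma borel_funP f : borel_fun f <-> measurable_fun setT f.
Proof.
split=> [bf _ B mB|mf B mB]; first by rewrite setTI; exact: bf.
by have := mf measurableT B mB; rewrite setTI.
Qed.

Lemma iint_EFin f : measurable_fun setT f -> (forall x, 0 <= f x) ->
  iint (fun x => (f x)%:E) = (\int[mu]_x (f x)%:E)%E.
Proof.
by move=> mf f0; rewrite iintE//; exact/measurable_EFinP.
Qed.

Lemma P2densP rho : P2dens rho <->
  [/\ measurable_fun setT rho, forall x, 0 <= rho x,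
      (\int[mu]_x (rho x)%:E = 1)%E & (\int[mu]_x (sqn x * rho x)%:E < +oo)%E].
Proof.
have E : measurable_fun setT rho -> (forall x, 0 <= rho x) ->
   iint (fun x => (enorm x ^+ 2 * rho x)%:E) = (\int[mu]_x (sqn x * rho x)%:E)%E.
  move=> mr r0; under eq_fun do rewrite enorm_sqr; rewrite iint_EFin//.
    by apply: measurable_funM => //; exact: measurable_sqn.
  by move=> x; rewrite mulr_ge0// sqn_ge0.
split=> [[/borel_funP mr r0 r1 r2]|[mr r0 r1 r2]].
  by split=> //; [rewrite -iint_EFin|rewrite -E].
by split => //; [exact/borel_funP|rewrite iint_EFin|rewrite E].
Qed.

End Densities.

Section Convolution.
Context {R : realType} {n : nat} (K rho : 'rV[R]_n -> R) (a c : R).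
Hypotheses (K0 : forall x, 0 <= K x) (Kc : convex_fun K) (a0 : 0 < a) (c0 : 0 <= c).
Hypothesis Kb : forall x, a * sqn x <= K x <= c * sqn x.
Hypothesis Hrho : P2dens rho.
Local Notation mu := (@leb R n).
Local Notation V := (convol K rho).

Let M := fine (\int[mu]_x (sqn x * rho x)%:E)%E.

Let mrho : measurable_fun setT rho. Proof. by case/P2densP : Hrho. Qed.
Let rho0 x : 0 <= rho x. Proof. by case/P2densP : Hrho. Qed.
Let rho1 : (\int[mu]_x (rho x)%:E = 1)%E. Proof. by case/P2densP : Hrho. Qed.

Let sqnrho0 x : 0 <= sqn x * rho x. Proof. by rewrite mulr_ge0 ?sqn_ge0. Qed.
Let msqnrho : measurable_fun setT (fun x => sqn x * rho x).
Proof. by apply: measurable_funM => //; exact: measurable_sqn. Qed.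

Let ME : (\int[mu]_x (sqn x * rho x)%:E)%E = M%:E.
Proof.
rewrite /M fineK// ge0_fin_numE; last exact: nnint_ge0.
by case/P2densP : Hrho.
Qed.

Let M0 : 0 <= M. Proof. by rewrite fine_ge0//; exact: nnint_ge0. Qed.

Lemma kernel_continuous : continuous K.
Proof.
apply: (@convex_continuous _ _ _ c 0) => // x; rewrite addr0 K0/=.
by have /andP[] := Kb x.
Qed.

Lemma measurable_kernel_shift (x : 'rV[R]_n) :
  measurable_fun setT (fun y : 'rV[R]_n => K (x - y) * rho y).
Proof.
apply: measurable_funM => //; apply: continuous_measurable_rV => y.
apply: (continuous_comp (f := fun y : 'rV[R]_n => x - y)); last exact: kernel_continuous.
by apply: (@cvgB _ _ _ (nbhs y)); [exact: cvg_cst|exact: cvg_id].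
Qed.

Let Krho0 x y : 0 <= K (x - y) * rho y. Proof. by rewrite mulr_ge0. Qed.

(** Integrate [sqn (x - y) <= 2 * sqn x + 2 * sqn y] against [rho]. The integral is thus finite, so
    [fine] in [convol] loses nothing. *)
Lemma convol_int_le x :
  (\int[mu]_y (K (x - y) * rho y)%:E <= (2 * c * sqn x + 2 * c * M)%:E)%E.
Proof.
apply: (@le_trans _ _ (\int[mu]_y (2 * c * sqn x * rho y + 2 * c * (sqn y * rho y))%:E)%E).
  apply: nnint_le => //.
  - exact: measurable_kernel_shift.
  - by apply: measurable_funD; exact: measurable_funM.
  - move=> y; have /andP[_ /le_trans K1] := Kb (x - y).
    rewrite !mulrA -mulrDl ler_wpM2r//; apply: K1.
    have := ler_wpM2l c0 (sqnD_le x (- y)); rewrite sqnN; lra.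
rewrite nnintD//.
- rewrite !nnintZ//; last 2 first.
  + by rewrite mulr_ge0.
  + by rewrite !mulr_ge0// sqn_ge0.
  by rewrite rho1 ME mule1 -EFinM -EFinD.
- exact: measurable_funM.
- exact: measurable_funM.
- by move=> y; rewrite !mulr_ge0// sqn_ge0.
- by move=> y; rewrite !mulr_ge0// sqn_ge0.
Qed.

Lemma convolE x : (V x)%:E = (\int[mu]_y (K (x - y) * rho y)%:E)%E.
Proof.
rewrite /convol iint_EFin//; last exact: measurable_kernel_shift.
rewrite fineK// ge0_fin_numE; last exact: nnint_ge0.
by apply: (le_lt_trans (convol_int_le x)); rewrite ltry.
Qed.

Lemma convol_ge0 x : 0 <= V x.
Proof. by rewrite -lee_fin convolE; exact: nnint_ge0. Qed.

Lemma convol_le : exists A B, [/\ 0 <= A, 0 <= B & forall x, V x <= A * sqn x + B].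
Proof.
exists (2 * c), (2 * c * M); split; [by rewrite mulr_ge0|by rewrite !mulr_ge0|move=> x].
by rewrite -lee_fin convolE convol_int_le.
Qed.

(** Coercivity: integrate [sqn x <= 2 * sqn (x - y) + 2 * sqn y] against the unit mass of [rho]. The
    inequality is arranged as a sum to avoid subtracting extended reals. *)
Lemma convol_ge : exists A B, 0 < A /\ forall x, A * sqn x - B <= V x.
Proof.
exists (a / 2), (a * M); split; [by rewrite divr_gt0|move=> x].
suff : a * sqn x <= 2 * V x + 2 * a * M by lra.
rewrite -lee_fin EFinD 2!EFinM convolE -[leLHS]mule1 -rho1 [(2 * a * M)%:E]EFinM -ME.
rewrite -!nnintZ//; try exact: measurable_kernel_shift;
  try by rewrite mulr_ge0 ?sqn_ge0// ltW.
rewrite -nnintD//; last 4 first.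
- by apply: measurable_funM => //; exact: measurable_kernel_shift.
- exact: measurable_funM.
- by move=> y; rewrite mulr_ge0.
- by move=> y; rewrite !mulr_ge0 ?sqn_ge0// ltW.
apply: nnint_le => //.
- exact: measurable_funM.
- apply: measurable_funD; last exact: measurable_funM.
  by apply: measurable_funM => //; exact: measurable_kernel_shift.
- by move=> y; rewrite !mulr_ge0 ?sqn_ge0// ltW.
- move=> y; have /andP[K1 _] := Kb (x - y).
  rewrite !mulrA -mulrDl ler_wpM2r//.
  have := ler_wpM2l (ltW a0) (sqnD_le (x - y) y); rewrite subrK; lra.
Qed.

Lemma convol_convex : convex_fun V.
Proof.
move=> x y t /andP[t0 t1]; rewrite -lee_fin EFinD !EFinM !convolE.
have t1' : 0 <= 1 - t by rewrite subr_ge0.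
rewrite -!nnintZ//; try exact: measurable_kernel_shift.
rewrite -nnintD//; try (by apply: measurable_funM => //; exact: measurable_kernel_shift);
  try (by move=> z; rewrite mulr_ge0).
apply: nnint_le => //.
- exact: measurable_kernel_shift.
- by apply: measurable_funD; apply: measurable_funM => //; exact: measurable_kernel_shift.
- move=> z; rewrite !mulrA -mulrDl ler_wpM2r//.
  have -> : t *: x + (1 - t) *: y - z = t *: (x - z) + (1 - t) *: (y - z).
    by apply/rowP => i; rewrite !mxE; ring.
  by apply: Kc; rewrite t0.
Qed.

Lemma convol_continuous : continuous V.
Proof.
have [A [B [A0 B0 VAB]]] := convol_le.
apply: (@convex_continuous _ _ _ A B) => //; first exact: convol_convex.
by move=> x; rewrite convol_ge0/=.
Qed.

End Convolution.

Lemma interaction_sym {R : realType} n (K rho1 rho2 : 'rV[R]_n -> R) a c :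
  (forall x, 0 <= K x) -> (forall x, K (- x) = K x) -> convex_fun K -> 0 < a -> 0 <= c ->
  (forall x, a * sqn x <= K x <= c * sqn x) -> P2dens rho1 -> P2dens rho2 ->
  (\int[leb n]_x (rho1 x * convol K rho2 x)%:E =
   \int[leb n]_x (rho2 x * convol K rho1 x)%:E)%E.
Proof.
move=> K0 Ks Kc a0 c0 Kb H1 H2.
have /P2densP[m1 r1 _ _] := H1; have /P2densP[m2 r2 _ _] := H2.
have E f g (Hf : P2dens f) (Hg : P2dens g) : (\int[leb n]_x (f x * convol K g x)%:E =
    \int[leb n]_x \int[leb n]_y (f x * g y * K (x - y))%:E)%E.
  have /P2densP[mf f0 _ _] := Hf; have /P2densP[mg g0 _ _] := Hg.
  apply: eq_integral => x _; rewrite EFinM (convolE K0 Kc c0 Kb Hg) -nnintZ//.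
  - by apply: eq_integral => y _; rewrite mulrA mulrAC.
  - exact: measurable_kernel_shift Kb Hg _.
  - by move=> y; rewrite mulr_ge0.
rewrite E// E//.
rewrite (@fubini_tonelli _ _ _ _ _ (leb n) (leb n)
  (fun p : 'rV[R]_n * 'rV[R]_n => (rho1 p.1 * rho2 p.2 * K (p.1 - p.2))%:E)).
- apply: eq_integral => x _; apply: eq_integral => y _ /=.
  by rewrite -Ks opprB (mulrC (rho1 _)).
- apply/measurable_EFinP; apply: measurable_funM.
    by apply: measurable_funM; [exact: measurableT_comp|exact: measurableT_comp].
  apply: (@measurableT_comp _ _ _ _ _ _ K).
    by apply: continuous_measurable_rV; exact: kernel_continuous Kb.
  apply: measurable_fun_rV => i.
  under eq_fun do rewrite !mxE.
  have mc := @measurable_coord R n i.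
  by apply: measurable_funB; apply: (measurableT_comp mc).
- by move=> p; rewrite lee_fin !mulr_ge0.
Qed.

(** * The Euler-Lagrange condition in one component *)

Lemma nnint_indic d (T : measurableType d) (R : realType) (mu : {measure set T -> \bar R})
  (s : R) (A : set T) : 0 <= s -> measurable A ->
  (\int[mu]_x (s * \1_A x)%:E = s%:E * mu A)%E.
Proof.
move=> s0 mA; rewrite nnintZ//.
by rewrite integral_indic// setIT.
Qed.

Lemma nnint_eq0P d (T : measurableType d) (R : realType) (mu : {measure set T -> \bar R})
  (f : T -> R) : measurable_fun setT f -> (forall x, 0 <= f x) ->
  (\int[mu]_x (f x)%:E = 0)%E <->
  exists N, [/\ measurable N, (mu N = 0)%E & forall x, ~ N x -> f x = 0].
Proof.
move=> mf f0.
have mEf : measurable_fun setT (EFin \o f) by exact/measurable_EFinP.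
rewrite (_ : (\int[mu]_x (f x)%:E)%E = (\int[mu]_x `|(EFin \o f) x|)%E); last first.
  by apply: eq_integral => x _; rewrite /= ger0_norm.
rewrite (ae_eq_integral_abs _ _ mEf)//; split=> -[N [mN N0 fN]]; exists N; split=> //.
  by move=> x Nx; apply: contrapT => fx; apply: Nx; apply: fN; move=> H; apply: fx; case: (H I).
by move=> x /= fx; apply: contrapT => /fN fx0; apply: fx => _; rewrite fx0.
Qed.

Section MeasurableLevelSets.
Context d (T : measurableType d) (R : realType).
Implicit Types f : T -> R.

Lemma measurable_level_lt f a : measurable_fun setT f -> measurable [set x | f x < a].
Proof.
move=> mf; rewrite (_ : [set x | _] = setT `&` f @^-1` `]-oo, a[%classic).
  exact: mf.
by apply/seteqP; split=> x /=; rewrite in_itv/=; [split|case].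
Qed.

Lemma measurable_level_gt f a : measurable_fun setT f -> measurable [set x | a < f x].
Proof.
move=> mf; rewrite (_ : [set x | _] = setT `&` f @^-1` `]a, +oo[%classic).
  exact: mf.
by apply/seteqP; split=> x /=; rewrite in_itv/= andbT; [split|case].
Qed.

Lemma measurable_level_ge f a : measurable_fun setT f -> measurable [set x | a <= f x].
Proof.
move=> mf; rewrite (_ : [set x | _] = setT `&` f @^-1` `[a, +oo[%classic).
  exact: mf.
by apply/seteqP; split=> x /=; rewrite in_itv/= andbT; [split|case].
Qed.

End MeasurableLevelSets.

Section EulerLagrange.
Context {R : realType} {n : nat}.
(** [p x] stands for the local integrand at [x] as a function of one density, the other being
    frozen; [p1 x] is its slope and [V] the potential created by the other density. The link between
    [p] and [p1] is expressed by [p_slope] alone. *)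
Variables (p p1 : 'rV[R]_n -> R -> R) (V rho : 'rV[R]_n -> R).
Local Notation mu := (@leb R n).
Local Notation J s := (\int[mu]_x (p x (s x) + s x * V x)%:E)%E.

Hypothesis mp : forall s : 'rV[R]_n -> R, measurable_fun setT s -> (forall x, 0 <= s x) ->
  measurable_fun setT (fun x => p x (s x)).
Hypothesis mp1 : forall s : 'rV[R]_n -> R, measurable_fun setT s -> (forall x, 0 <= s x) ->
  measurable_fun setT (fun x => p1 x (s x)).
Hypothesis p_ge0 : forall x r, 0 <= r -> 0 <= p x r.
Hypothesis p1_0 : forall x, p1 x 0 = 0.
Hypothesis p1_incr : forall x r s, 0 <= r -> r < s -> p1 x r < p1 x s.
Hypothesis p1_cont : forall x r, 0 <= r -> forall e, 0 < e -> exists2 d, 0 < d &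
  forall s, 0 <= s -> `|s - r| < d -> `|p1 x s - p1 x r| < e.
Hypothesis p_slope : forall x r s, 0 <= r -> 0 <= s ->
  s * p1 x r <= p x (r + s) - p x r <= s * p1 x (r + s).
Hypothesis V_ge0 : forall x, 0 <= V x.
Hypothesis V_cont : continuous V.
Hypothesis Hrho : P2dens rho.
Hypothesis J_fin : (J rho < +oo)%E.
Hypothesis J_min : forall s, P2dens s -> (J rho <= J s)%E.

Let mrho : measurable_fun setT rho. Proof. by case/P2densP : Hrho. Qed.
Let rho0 x : 0 <= rho x. Proof. by case/P2densP : Hrho. Qed.
Let rho1 : (\int[mu]_x (rho x)%:E = 1)%E. Proof. by case/P2densP : Hrho. Qed.
Let rho2 : (\int[mu]_x (sqn x * rho x)%:E < +oo)%E. Proof. by case/P2densP : Hrho. Qed.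
Let mV : measurable_fun setT V. Proof. exact: continuous_measurable_rV. Qed.

Lemma slope_le x r s : 0 <= r -> r <= s -> p1 x r <= p1 x s.
Proof.
by move=> r0; rewrite le_eqVlt => /predU1P[->//|rs]; rewrite ltW// p1_incr.
Qed.

Let t (k : nat) : R := k.+1%:R^-1.
Let t_gt0 k : 0 < t k. Proof. by rewrite invr_gt0. Qed.

(* [p1 + V] is the marginal cost of mass: adding mass at most [t k] on [cheap k a]
   costs less than [a] per unit, removing it from [dear k b] saves more than [b]. *)
Definition cheap k a := ball (0 : 'rV[R]_n) k.+1%:R `&`
  [set x | p1 x (rho x + t k) + V x < a].

Definition dear k b := ball (0 : 'rV[R]_n) k.+1%:R `&`
  ([set x | t k <= rho x] `&` [set x | b < p1 x (Num.max (rho x - t k) 0) + V x]).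

Lemma measurable_cheap k a : measurable (cheap k a).
Proof.
apply: measurableI; first exact: measurable_ball_rV.
apply: measurable_level_lt; apply: measurable_funD => //; apply: mp1.
  by apply: measurable_funD.
by move=> x; rewrite addr_ge0// ltW.
Qed.

Lemma measurable_dear k b : measurable (dear k b).
Proof.
apply: measurableI; first exact: measurable_ball_rV.
apply: measurableI; first exact: measurable_level_ge.
apply: measurable_level_gt; apply: measurable_funD => //; apply: mp1.
  by apply: measurable_maxr => //; apply: measurable_funB.
by move=> x; rewrite le_max lexx orbT.
Qed.

Lemma leb_sub_ball_lty (A : set 'rV[R]_n) r : 0 < r -> measurable A ->
  A `<=` ball 0 r -> (mu A < +oo)%E.
Proof.
move=> r0 mA AB; apply: (@le_lt_trans _ _ (mu (ball 0 r))); last by rewrite leb_ball// ltry.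
by apply: le_measure => //; rewrite inE//; exact: measurable_ball_rV.
Qed.

(** The same mass [q] is added on [A] and removed on [B], so the total stays 1; the second moment
    stays finite because [A] is bounded. *)
Lemma mass_transfer (A B : set 'rV[R]_n) r s s' q : 0 < r -> 0 <= s -> 0 <= s' ->
  measurable A -> measurable B -> A `<=` ball 0 r ->
  (s%:E * mu A = q%:E)%E -> (s'%:E * mu B = q%:E)%E ->
  (forall x, 0 <= rho x + s * \1_A x - s' * \1_B x) ->
  P2dens (fun x => rho x + s * \1_A x - s' * \1_B x).
Proof.
move=> r0 s0 s'0 mA mB Ar sA s'B sig0.
have mI k (C : set 'rV[R]_n) : measurable C -> measurable_fun setT (fun x => k * (\1_C x : R)).
  by move=> mC; apply: measurable_funM => //; exact: measurable_indic.
have I0 k (C : set 'rV[R]_n) x : 0 <= k -> 0 <= k * (\1_C x : R).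
  by move=> k0; rewrite mulr_ge0.
have msig : measurable_fun setT (fun x => rho x + s * \1_A x - s' * \1_B x).
  apply: measurable_funB; last exact: mI.
  by apply: measurable_funD => //; exact: mI.
apply/P2densP; split => //.
(* The removed mass is added to both sides, so that only nonnegative functions are integrated; the
   finite [q] then cancels. *)
- have E : (\int[mu]_x (rho x + s * \1_A x - s' * \1_B x)%:E + q%:E = 1 + q%:E)%E.
    rewrite -{1}s'B -nnint_indic// -nnintD//; [|exact: mI|by move=> x; exact: I0].
    under eq_integral do rewrite subrK.
    rewrite nnintD//; [|exact: mI|by move=> x; exact: I0].
    by rewrite nnint_indic// sA rho1.
  move: E; case: (\int[mu]_x _)%E => [z| |]//.
  by rewrite -!EFinD => -[/addIr ->].
- pose Sr := \sum_(i < n) (`|(0 : 'rV[R]_n) ord0 i| + r) ^+ 2.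
  have Sr0 : 0 <= Sr by apply: sumr_ge0 => i _; exact: sqr_ge0.
  apply: (@le_lt_trans _ _ (\int[mu]_x (sqn x * rho x + Sr * s * \1_A x)%:E)%E).
    apply: nnint_le.
    + by apply: measurable_funM => //; exact: measurable_sqn.
    + apply: measurable_funD; last exact: mI.
      by apply: measurable_funM => //; exact: measurable_sqn.
    + by move=> x; rewrite mulr_ge0// sqn_ge0.
    + move=> x; apply: (@le_trans _ _ (sqn x * (rho x + s * \1_A x))).
        by rewrite ler_wpM2l ?sqn_ge0// lerBlDr lerDl I0.
      rewrite mulrDr lerD2l mulrA !indicE; have [/set_mem xA|_] := boolP (x \in A).
        by rewrite !mulr1 ler_wpM2r//; apply: sqn_ball_le; [exact: ltW|exact: Ar].
      by rewrite !mulr0.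
  rewrite nnintD//.
  + rewrite nnint_indic ?mulr_ge0// EFinM -muleA sA -EFinM.
    by rewrite lte_add_pinfty// ltry.
  + by apply: measurable_funM => //; exact: measurable_sqn.
  + exact: mI.
  + by move=> x; rewrite mulr_ge0// sqn_ge0.
  + by move=> x; rewrite I0// mulr_ge0.
Qed.

(** If both sets had positive measure, moving a mass [q] from the dear one to the cheap one would
    lower [J] by at least [q * (b - a)], against minimality. *)
Lemma cheap_dear k l a b : a < b -> (mu (cheap k a) = 0 \/ mu (dear l b) = 0)%E.
Proof.
move=> ab; set A := cheap k a; set B := dear l b.
have mA : measurable A by exact: measurable_cheap.
have mB : measurable B by exact: measurable_dear.
have [->|A0] := eqVneq (mu A) 0%E; first by left.
have [->|B0] := eqVneq (mu B) 0%E; [by right|exfalso].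
have Ak : A `<=` ball 0 k.+1%:R by move=> x [].
have Afin : (mu A < +oo)%E by apply: (leb_sub_ball_lty _ mA Ak).
have Bfin : (mu B < +oo)%E.
  by apply: (@leb_sub_ball_lty _ l.+1%:R) => // x [].
pose vA := fine (mu A); pose vB := fine (mu B).
have vAE : mu A = vA%:E by rewrite fineK// ge0_fin_numE.
have vBE : mu B = vB%:E by rewrite fineK// ge0_fin_numE.
have vA0 : 0 < vA by rewrite -lte_fin -vAE lt0e A0/=.
have vB0 : 0 < vB by rewrite -lte_fin -vBE lt0e B0/=.
(* The heights [s] and [s'] are proportional to the measure of the opposite set, so that added and
   removed masses agree; the minimum keeps them below the steps [t k] and [t l]. *)
pose c := Num.min (t k / vB) (t l / vA).
have c0 : 0 < c by rewrite lt_min !divr_gt0.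
pose s := c * vB; pose s' := c * vA; pose q := s * vA.
have s0 : 0 < s by rewrite mulr_gt0.
have s'0 : 0 < s' by rewrite mulr_gt0.
have q0 : 0 < q by rewrite mulr_gt0.
have st : s <= t k by rewrite -ler_pdivlMr// ge_min lexx.
have s't : s' <= t l by rewrite -ler_pdivlMr// ge_min lexx orbT.
have sA : (s%:E * mu A = q%:E)%E by rewrite vAE -EFinM.
have s'B : (s'%:E * mu B = q%:E)%E by rewrite vBE -EFinM; congr EFin; rewrite /q /s /s'; ring.
have disj x : A x -> B x -> False.
  move=> [_ /= xa] [_ [/= tx xb]].
  have : p1 x (Num.max (rho x - t l) 0) <= p1 x (rho x + t k).
    apply: slope_le; first by rewrite le_max lexx orbT.
    by rewrite max_l ?subr_ge0// lerD2l; apply: (@le_trans _ _ 0); rewrite ?oppr_le0 ltW.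
  lra.
pose sig x := rho x + s * \1_A x - s' * \1_B x.
have sig0 x : 0 <= sig x.
  rewrite /sig !indicE; have [/set_mem xB|_] := boolP (x \in B); last first.
    by rewrite mulr0 subr0 addr_ge0// mulr_ge0// ltW.
  rewrite memNset; last by move=> /disj; apply.
  rewrite mulr0 addr0 mulr1 subr_ge0; case: xB => _ [/= tx _].
  exact: le_trans tx.
have Hsig : P2dens sig.
  by apply: (mass_transfer (q := q) _ _ _ mA mB Ak) => //; exact: ltW.
(* Marginal costs are nonnegative, so [a] and then [b] are positive; this keeps all integrands below
   nonnegative. *)
have a_gt0 x : A x -> 0 < a.
  move=> [_ /= xa]; apply: le_lt_trans xa; rewrite addr_ge0//.
  by rewrite -(p1_0 x) slope_le// addr_ge0// ltW.
have a0 : 0 < a.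
  have /set0P[x Ax] : A != set0 by apply: contraNneq A0 => ->; rewrite measure0.
  exact: a_gt0 Ax.
have b0 : 0 < b by exact: lt_trans ab.
(* Gain on the left, cost on the right: the comparison integrates term by term in the extended
   reals. On [A] it uses the upper slope bound, on [B] the lower one. *)
have pw x : p x (sig x) + sig x * V x + s' * b * \1_B x <=
            p x (rho x) + rho x * V x + s * a * \1_A x.
  rewrite /sig !indicE; have [/set_mem xA|xA] := boolP (x \in A).
    rewrite memNset; last by move=> /(disj _ xA).
    rewrite !mulr1 !mulr0 subr0 addr0.
    have /andP[_ H] := p_slope x (rho0 x) (ltW s0).
    have H2 : p1 x (rho x + s) <= p1 x (rho x + t k).
      by apply: slope_le; [rewrite addr_ge0// ltW|rewrite lerD2l].
    case: xA => _ /= H3; nra.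
  have [/set_mem xB|xB] := boolP (x \in B); last by rewrite !mulr0 subr0 !addr0.
  rewrite !mulr1 !mulr0 !addr0; case: xB => _ [/= tx xb].
  have r0 : 0 <= rho x - s' by rewrite subr_ge0; exact: le_trans tx.
  have /andP[H _] := p_slope x r0 (ltW s'0); rewrite subrK in H.
  have H2 : p1 x (Num.max (rho x - t l) 0) <= p1 x (rho x - s').
    apply: slope_le; first by rewrite le_max lexx orbT.
    by rewrite max_l ?subr_ge0// lerD2l lerN2.
  nra.
have msig : measurable_fun setT sig by case/P2densP : Hsig.
have mI e (C : set 'rV[R]_n) : measurable C -> measurable_fun setT (fun x => e * (\1_C x : R)).
  by move=> mC; apply: measurable_funM => //; exact: measurable_indic.
have mJ (w : 'rV[R]_n -> R) : measurable_fun setT w -> (forall x, 0 <= w x) ->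
    measurable_fun setT (fun x => p x (w x) + w x * V x).
  by move=> mw w0; apply: measurable_funD; [exact: mp|exact: measurable_funM].
have J0 (w : 'rV[R]_n -> R) : (forall x, 0 <= w x) -> forall x, 0 <= p x (w x) + w x * V x.
  by move=> w0 x; rewrite addr_ge0 ?mulr_ge0 ?p_ge0.
have : (J sig + (q * b)%:E <= J rho + (q * a)%:E)%E.
  have -> : (q * b)%:E = (\int[mu]_x (s' * b * \1_B x)%:E)%E.
    by rewrite nnint_indic ?mulr_ge0 ?ltW// (mulrC s') [(b * s')%:E]EFinM -muleA s'B -EFinM mulrC.
  have -> : (q * a)%:E = (\int[mu]_x (s * a * \1_A x)%:E)%E.
    by rewrite nnint_indic ?mulr_ge0 ?ltW// (mulrC s) [(a * s)%:E]EFinM -muleA sA -EFinM mulrC.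
  rewrite -!nnintD//; try exact: mJ; try exact: mI; try exact: J0;
    try by move=> x; rewrite !mulr_ge0// ltW.
  apply: nnint_le => //.
  - by apply: measurable_funD; [exact: mJ|exact: mI].
  - by apply: measurable_funD; [exact: mJ|exact: mI].
  - by move=> x; rewrite addr_ge0 ?J0// !mulr_ge0// ltW.
have := J_min Hsig.
have : J rho \is a fin_num by rewrite ge0_fin_numE//; apply: nnint_ge0; exact: J0.
move=> /fineK <-; case: (J sig) => [z| |]//.
rewrite -!EFinD !lee_fin => Hz H.
by move: H; apply/negP; rewrite -ltNge; nra.
Qed.

Lemma small_step (d M : R) : 0 < d -> exists k, t k < d /\ M < k.+1%:R.
Proof.
move=> d0; exists (Num.truncn (Num.max d^-1 M)).
have := truncnS_gt (Num.max d^-1 M); rewrite gt_max => /andP[dk Mk]; split => //.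
by rewrite /t -[ltRHS]invrK ltf_pV2 ?posrE ?invr_gt0 ?ltr0n.
Qed.

Lemma leb_setT_neq0 : (mu setT != 0)%E.
Proof. by rewrite gt_eqF// leb_open_gt0//; [exact: openT|exists 0]. Qed.

Lemma null_bigcup (F : nat -> set 'rV[R]_n) : (forall k, measurable (F k)) ->
  (forall k, mu (F k) = 0)%E -> (mu (\bigcup_k F k) = 0)%E.
Proof.
move=> mF F0; apply: measure_negligible; first exact: bigcup_measurable.
by apply: negligible_bigcup => k; exists (F k); split; [exact: mF|exact: F0|].
Qed.

Lemma ball0E (x : 'rV[R]_n) r : `|x| < r -> ball 0 r x.
Proof. by move=> xr; rewrite -ball_normE /= sub0r normrN. Qed.

Lemma euler_lagrange : exists C N, [/\ 0 < C, measurable N, (mu N = 0)%E &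
  forall x, ~ N x -> p1 x (rho x) = Num.max (C - V x) 0].
Proof.
(* The constant will be the infimum of [S], an essential infimum of the marginal cost. *)
pose S := [set a : R | exists k, mu (cheap k a) != 0%E].
have S_ge0 a : S a -> 0 <= a.
  move=> [k ka]; rewrite leNgt; apply/negP => a0; move: ka; apply/negP; rewrite negbK.
  rewrite (_ : cheap k a = set0) ?measure0//; apply/seteqP; split=> // x [_ /=].
  have : 0 <= p1 x (rho x + t k) by rewrite -(p1_0 x) slope_le// addr_ge0// ltW.
  have := V_ge0 x; lra.
have S_lb : has_lbound S by exists 0 => a /S_ge0.
have S_ne : S !=set0.
  (* Were [S] empty, the sets [cheap k k.+1%:R], which cover the whole space, would all be null. *)
  apply: contrapT => S0; move/negP: leb_setT_neq0; apply; apply/eqP.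
  rewrite (_ : setT = \bigcup_k cheap k k.+1%:R).
    apply: null_bigcup => k; first exact: measurable_cheap.
    by apply: contrapT => /eqP H; apply: S0; exists k.+1%:R, k.
  apply/seteqP; split=> // x _.
  have [k [_]] := small_step (Num.max `|x| (p1 x (rho x + 1) + V x)) ltr01.
  rewrite gt_max => /andP[xk Vk]; exists k => //; split; first exact: ball0E.
  apply: le_lt_trans Vk; rewrite lerD2r slope_le//; first by rewrite addr_ge0// ltW.
  by rewrite lerD2l invf_le1 ?ler1n.
pose C := inf S.
have cheap0 k j : mu (cheap k (C - t j)) = 0%E.
  apply: contrapT => /eqP H; have : C <= C - t j by apply: ge_inf => //; exists k.
  by have := t_gt0 j; lra.
(* Some level [a] of [S] lies below [C + t j]; its cheap set has positive measure, so the dear set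
   must be null. *)
have dear0 k j : mu (dear k (C + t j)) = 0%E.
  have [a [l la] aC] := inf_adherent (t_gt0 j) (conj S_ne S_lb).
  by have [/eqP|//] := cheap_dear l k aC; rewrite (negbTE la).
pose N := (\bigcup_k \bigcup_j cheap k (C - t j)) `|` (\bigcup_k \bigcup_j dear k (C + t j)).
have mN1 : measurable (\bigcup_k \bigcup_j cheap k (C - t j)).
  by apply: bigcup_measurable => k _; apply: bigcup_measurable => j _; exact: measurable_cheap.
have mN2 : measurable (\bigcup_k \bigcup_j dear k (C + t j)).
  by apply: bigcup_measurable => k _; apply: bigcup_measurable => j _; exact: measurable_dear.
have mN : measurable N by exact: measurableU.
have N0 : (mu N = 0)%E.
  apply: measure_negligible => //; apply: negligibleU.
    exists (\bigcup_k \bigcup_j cheap k (C - t j)); split=> //.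
    apply: null_bigcup => k; first by apply: bigcup_measurable => j _; exact: measurable_cheap.
    by apply: null_bigcup => j; first exact: measurable_cheap.
  exists (\bigcup_k \bigcup_j dear k (C + t j)); split=> //.
  apply: null_bigcup => k; first by apply: bigcup_measurable => j _; exact: measurable_dear.
  by apply: null_bigcup => j; first exact: measurable_dear.
(* If the cost at [x] were below [C], continuity of [p1 x] would keep it below some [C - t j] after
   a small step [t k], placing [x] in a set collected in [N]. The bound [up] is symmetric, with a
   step also smaller than [rho x]. *)
have lo x : ~ N x -> C <= p1 x (rho x) + V x.
  move=> Nx; rewrite leNgt; apply/negP => gC; apply: Nx; left.
  have [j [jC _]] := @small_step (C - (p1 x (rho x) + V x)) 0 ltac:(lra).
  have [d d0 H] := @p1_cont x (rho x) (rho0 x) (C - t j - (p1 x (rho x) + V x)) ltac:(lra).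
  have [k [kd xk]] := small_step `|x| d0.
  exists k => //; exists j => //; split; first exact: ball0E.
  have := H (rho x + t k); have -> : rho x + t k - rho x = t k by ring.
  have -> : 0 <= rho x + t k by rewrite addr_ge0// ltW.
  rewrite ger0_norm ?ltW// => /(_ isT kd); rewrite ltr_norml => /andP[_ /=]; lra.
have up x : ~ N x -> 0 < rho x -> p1 x (rho x) + V x <= C.
  move=> Nx r0; rewrite leNgt; apply/negP => gC; apply: Nx; right.
  have [j [jC _]] := @small_step (p1 x (rho x) + V x - C) 0 ltac:(lra).
  have [d d0 H] := @p1_cont x (rho x) (rho0 x) (p1 x (rho x) + V x - (C + t j)) ltac:(lra).
  have [k [kd xk]] := @small_step (Num.min d (rho x)) `|x| ltac:(by rewrite lt_min d0).
  move: kd; rewrite lt_min => /andP[kd kr].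
  have r1 : 0 <= rho x - t k by rewrite subr_ge0 ltW.
  exists k => //; exists j => //; split; first exact: ball0E.
  split; first exact: ltW.
  rewrite /= max_l//; have := H _ r1; have -> : rho x - t k - rho x = - t k by ring.
  rewrite normrN ger0_norm ?ltW//.
  by move=> /(_ kd); rewrite ltr_norml => /andP[/=]; lra.
have main x : ~ N x -> p1 x (rho x) = Num.max (C - V x) 0.
  move=> Nx; have := lo x Nx; have := rho0 x.
  rewrite le_eqVlt => /predU1P[<-|r0 H].
    by rewrite p1_0 => H; rewrite max_r//; lra.
  have := up x Nx r0; have := @p1_incr x 0 (rho x) (lexx 0) r0; rewrite p1_0 => H1 H2.
  by rewrite max_l; lra.
exists C, N; split => //.
(* With [C <= 0], positive density would force a positive cost at most [C]; so [rho] would vanish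
   almost everywhere, contradicting its unit mass. *)
rewrite ltNge; apply/negP => C0.
suff : (\int[mu]_x (rho x)%:E = 0)%E by rewrite rho1 => /eqP; rewrite eqe oner_eq0.
apply/nnint_eq0P => //; exists N; split => // x Nx.
apply: contrapT => r0; have r0' : 0 < rho x by rewrite lt0r rho0 andbT; exact/eqP.
have := up x Nx r0'; have := @p1_incr x 0 (rho x) (lexx 0) r0'; rewrite p1_0.
have := V_ge0 x; lra.
Qed.

(** * Sublevel sets of the potential and the support of the density *)

Hypothesis V_convex : convex_fun V.
Hypothesis V_coercive : exists A B, 0 < A /\ forall x, A * sqn x - B <= V x.

Lemma sublevel_convex C : convex_set_rV [set x | V x <= C].
Proof.
move=> x y /= Vx Vy s s01; apply: (le_trans (V_convex x y s01)).
by case/andP : s01 => s0 s1; nra.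
Qed.

Lemma sublevel_compact C : compact [set x | V x <= C].
Proof.
apply: bounded_closed_compact.
  have [A [B [A0 HV]]] := V_coercive.
  pose Q := (C + B) / A.
  exists (`|Q| + 1); split; first exact: num_real.
  move=> M QM x /= VC; apply: (le_trans _ (ltW QM)).
  have : `|x| ^+ 2 <= Q.
    apply: (le_trans (norm_le_sqn x)); rewrite ler_pdivlMr// mulrC.
    by have := HV x; lra.
  have := ler_norm Q; have := normr_ge0 x; nra.
rewrite (_ : [set x | _] = ~` (V @^-1` [set y | C < y])).
  apply: open_closedC; move/continuousP : V_cont; apply; exact: open_gt.
by apply/seteqP; split=> x /=; rewrite ltNge; [move=> ->|move/negP; rewrite negbK].
Qed.

(** Off [N], the density is positive exactly where [V x < C]. The region [C < V] is open and carries
    no mass, while convexity makes every point of [V <= C] a limit of points with [V < C]. *)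
Lemma support_sublevel C N : measurable N -> (mu N = 0)%E ->
  (forall x, ~ N x -> p1 x (rho x) = Num.max (C - V x) 0) ->
  supp_dens rho = [set x | V x <= C].
Proof.
move=> mN N0 EL.
have pos x : ~ N x -> V x < C -> 0 < rho x.
  move=> /EL + VC; rewrite lt0r rho0 andbT => H; apply/eqP => r0; move: H.
  rewrite r0 p1_0 max_l ?subr_ge0 ?ltW// => /esym/eqP; rewrite subr_eq0 => /eqP CV.
  by move: VC; rewrite CV ltxx.
have zer x : ~ N x -> C <= V x -> rho x = 0.
  move=> /EL + VC; rewrite max_r ?subr_le0// => H; apply: contrapT => /eqP r0.
  have : 0 < rho x by rewrite lt0r r0 rho0.
  by move=> /(@p1_incr x 0 _ (lexx 0)); rewrite p1_0 H ltxx.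
have mB x r : measurable [set z : 'rV[R]_n | enorm (z - x) < r].
  by apply: open_measurable_rV; exact: enorm_ball_open.
have mrB x r : measurable_fun setT (fun y => rho y * (\1_[set z | enorm (z - x) < r] y : R)).
  by apply: measurable_funM => //; apply: measurable_indic.
have rB0 x r y : 0 <= rho y * (\1_[set z | enorm (z - x) < r] y : R) by rewrite mulr_ge0.
apply/seteqP; split=> x /=.
  move=> xs; rewrite leNgt; apply/negP => CV.
  have /nbhs_ballP[r /= r0 rC] : nbhs x (V @^-1` [set y | C < y]).
    apply: open_nbhs_nbhs; split => //; move/continuousP : V_cont; apply; exact: open_gt.
  have := xs r r0; rewrite iint_EFin//.
  rewrite (_ : (\int[mu]_x _)%E = 0%E) ?ltxx//.
  apply/nnint_eq0P => //; exists N; split => // y Ny.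
  rewrite indicE; have [/set_mem /= yx|_] := boolP (y \in _); last by rewrite mulr0.
  (* Supports use Euclidean balls, the topology uses the sup norm; the Euclidean ball is the smaller
     one. *)
  rewrite zer ?mul0r// ltW//; apply: rC; rewrite -ball_normE /= distrC.
  apply: le_lt_trans yx; rewrite -(@ler_pXn2r _ 2) ?nnegrE ?enorm_ge0//.
  by rewrite enorm_sqr norm_le_sqn.
move=> VC r r0; rewrite iint_EFin// lt0e nnint_ge0// andbT; apply/eqP.
move=> /(nnint_eq0P _ (mrB x r) (rB0 x r))[N' [mN' N'0 H]].
(* Otherwise the density would vanish almost everywhere. *)
have [y Vy] : exists y, V y < C.
  apply: contrapT => Vn.
  suff : (\int[mu]_x (rho x)%:E = 0)%E by rewrite rho1 => /eqP; rewrite eqe oner_eq0.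
  apply/nnint_eq0P => //; exists N; split => // y Ny; apply: zer => //.
  by rewrite leNgt; apply/negP => Vy; apply: Vn; exists y.
pose O := [set z | enorm (z - x) < r] `&` V @^-1` [set v | v < C].
have oO : open O.
  apply: openI; first exact: enorm_ball_open.
  by move/continuousP : V_cont; apply; exact: open_lt.
have : (0 < mu O)%E.
  apply: leb_open_gt0 => //.
  (* A point on the segment from [x] to [y], at distance at most [r / 2] from [x]; convexity makes
     [V] strictly less than [C] there. *)
  pose s := Num.min 1 (r / 2 / (enorm (y - x) + 1)).
  have e1 : 0 < enorm (y - x) + 1 by rewrite ltr_wpDl// enorm_ge0.
  have s0 : 0 < s by rewrite lt_min ltr01 !divr_gt0.
  have s1 : s <= 1 by rewrite ge_min lexx.
  exists (s *: y + (1 - s) *: x); split => /=.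
    have -> : s *: y + (1 - s) *: x - x = s *: (y - x).
      by apply/rowP => i; rewrite !mxE; ring.
    rewrite enormZ ?ltW//.
    have : s * (enorm (y - x) + 1) <= r / 2 by rewrite -ler_pdivlMr// ge_min lexx orbT.
    by have := enorm_ge0 (y - x); lra.
  have : 0 <= s <= 1 by rewrite ltW.
  by move=> /(V_convex y x) /le_lt_trans; apply; nra.
apply/negP; rewrite -leNgt; apply: (@le_trans _ _ (mu (N `|` N'))).
  apply: le_measure; rewrite ?inE//; first exact: open_measurable_rV.
    exact: measurableU.
  move=> z [/= zx Vz]; apply: contrapT => /not_orP[Nz N'z].
  have := H z N'z; rewrite indicE mem_set// mulr1 => rz.
  by have := pos z Nz Vz; rewrite rz ltxx.
apply: (le_trans (measureU2 _ _ _)) => //=.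
by rewrite N0 N'0 adde0.
Qed.

End EulerLagrange.

(** * Convexity of the integrand *)

Section HalfLine.
Context {R : realType}.
Implicit Types (f g : R -> R) (G : R -> R -> R).

(** Epsilon-delta forms of continuity within the half-line and the quadrant, which pass directly to
    slices and to exchanged arguments. *)
Definition cont_half f := forall r, 0 <= r -> forall e, 0 < e -> exists2 d, 0 < d &
  forall s, 0 <= s -> `|s - r| < d -> `|f s - f r| < e.

Definition cont_quad G := forall r1 r2, 0 <= r1 -> 0 <= r2 -> forall e, 0 < e ->
  exists2 d, 0 < d & forall s1 s2, 0 <= s1 -> 0 <= s2 ->
    `|s1 - r1| < d -> `|s2 - r2| < d -> `|G s1 s2 - G r1 r2| < e.

Lemma within_cont_half f : {within [set r | 0 <= r], continuous f} -> cont_half f.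
Proof.
move=> /subspace_continuousP cf r r0 e e0.
have /cvgrPdist_lt/(_ e e0)/nbhs_ballP[d /= d0 H] := cf r r0.
exists d => // s s0 sr; rewrite distrC; apply: H => //.
by rewrite -ball_normE /= distrC.
Qed.

Lemma within_cont_quad G :
  {within quadrant, continuous (fun p : R * R => G p.1 p.2)} -> cont_quad G.
Proof.
move=> /subspace_continuousP cG r1 r2 r10 r20 e e0.
have /cvgrPdist_lt/(_ e e0)/nbhs_ballP[d /= d0 H] := cG (r1, r2) (conj r10 r20).
exists d => // s1 s2 s10 s20 sr1 sr2; rewrite distrC; apply: (H (s1, s2)) => //.
by split; rewrite -ball_normE /= distrC.
Qed.

Lemma cont_half_within f a b : cont_half f -> 0 <= a -> {within `[a, b], continuous f}.
Proof.
move=> cf a0; apply/subspace_continuousP => r /=; rewrite in_itv/= => /andP[ar rb].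
apply/cvgrPdist_lt => e e0; have [d d0 H] := cf r (le_trans a0 ar) e e0.
apply/nbhs_ballP; exists d => //= s; rewrite -ball_normE /= => sr.
rewrite in_itv/= => /andP[as_ sb]; rewrite distrC; apply: H; first exact: le_trans as_.
by rewrite distrC.
Qed.

Lemma cont_quadD G H : cont_quad G -> cont_quad H ->
  cont_quad (fun r1 r2 => G r1 r2 + H r1 r2).
Proof.
move=> cG cH r1 r2 r10 r20 e e0; have e2 : 0 < e / 2 by rewrite divr_gt0.
have [d d0 Hd] := cG r1 r2 r10 r20 _ e2; have [c c0 Hc] := cH r1 r2 r10 r20 _ e2.
exists (Num.min d c); first by rewrite lt_min d0.
move=> s1 s2 s10 s20; rewrite !lt_min => /andP[d1 c1] /andP[d2 c2].
have := Hd s1 s2 s10 s20 d1 d2; have := Hc s1 s2 s10 s20 c1 c2.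
rewrite !ltr_norml => /andP[? ?] /andP[? ?]; apply/andP; split; lra.
Qed.

Lemma cont_quadZ k G : cont_quad G -> cont_quad (fun r1 r2 => k * G r1 r2).
Proof.
move=> cG r1 r2 r10 r20 e e0; have k0 : 0 < `|k| + 1 by rewrite ltr_wpDl.
have [d d0 H] := cG r1 r2 r10 r20 (e / (`|k| + 1)) (divr_gt0 e0 k0).
exists d => // s1 s2 s10 s20 h1 h2; have := H s1 s2 s10 s20 h1 h2.
rewrite ltr_pdivlMr// -mulrBr normrM => Hs.
by apply: le_lt_trans Hs; rewrite mulrC ler_wpM2l// lerDl.
Qed.

Lemma cont_quad_slice G r2 : cont_quad G -> 0 <= r2 -> cont_half (fun r => G r r2).
Proof.
move=> cG r20 r r0 e e0; have [d d0 H] := cG r r2 r0 r20 e e0.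
by exists d => // s s0 sr; apply: H => //; rewrite subrr normr0.
Qed.

Lemma cont_quad_swap G : cont_quad G -> cont_quad (fun r1 r2 => G r2 r1).
Proof.
move=> cG r1 r2 r10 r20 e e0; have [d d0 H] := cG r2 r1 r20 r10 e e0.
by exists d => // s1 s2 s10 s20 h1 h2; apply: H.
Qed.

Lemma cont_half_quad f : cont_half f -> cont_quad (fun r _ => f r).
Proof.
move=> cf r1 r2 r10 _ e e0; have [d d0 H] := cf r1 r10 e e0.
by exists d => // s1 s2 s10 _ h1 _; exact: H.
Qed.

Lemma cont_halfD f g : cont_half f -> cont_half g -> cont_half (fun r => f r + g r).
Proof.
move=> cf cg.
exact: (cont_quad_slice (cont_quadD (cont_half_quad cf) (cont_half_quad cg)) (lexx 0)).
Qed.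

Lemma cont_halfZ k f : cont_half f -> cont_half (fun r => k * f r).
Proof.
by move=> cf; exact: (cont_quad_slice (cont_quadZ k (cont_half_quad cf)) (lexx 0)).
Qed.

Lemma cont_quad_measurable d (T : measurableType d) G (u v : T -> R) : cont_quad G ->
  measurable_fun setT u -> measurable_fun setT v ->
  (forall x, 0 <= u x) -> (forall x, 0 <= v x) ->
  measurable_fun setT (fun x => G (u x) (v x)).
Proof.
move=> cG mu_ mv u0 v0.
pose w x : 'rV[R]_2 := \row_i (if i == ord0 then u x else v x).
(* Clamping at 0 extends [G] continuously from the quadrant to the plane without changing it at the
   nonnegative values of [u] and [v]. *)
pose H (y : 'rV[R]_2) := G (Num.max (y ord0 ord0) 0) (Num.max (y ord0 (lift ord0 ord0)) 0).
have -> : (fun x => G (u x) (v x)) = H \o w.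
  by apply/funext => x; rewrite /H /w /= !mxE/= !max_l.
apply: measurableT_comp.
  apply: continuous_measurable_rV => y; apply/(@cvgrPdist_lt _ _ _ (nbhs y)) => e e0.
  have m0 (z : R) : 0 <= Num.max z 0 by rewrite le_max lexx orbT.
  have mlip (z z' : R) : `|Num.max z 0 - Num.max z' 0| <= `|z - z'|.
    have := ler_norm (z - z'); have := ler_norm (z' - z); rewrite (distrC z' z) => A B.
    have C := normr_ge0 (z - z'); rewrite ler_norml.
    by case: (leP z 0) => ?; case: (leP z' 0) => ?; apply/andP; split; lra.
  have [dl dl0 HG] := cG _ _ (m0 (y ord0 ord0)) (m0 (y ord0 (lift ord0 ord0))) e e0.
  apply/nbhs_ballP; exists dl => //= z [_ yz]; rewrite distrC; apply: HG => //.
    apply: (le_lt_trans (mlip _ _)); have := yz ord0 ord0.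
    by rewrite -ball_normE /= distrC.
  apply: (le_lt_trans (mlip _ _)); have := yz ord0 (lift ord0 ord0).
  by rewrite -ball_normE /= distrC.
apply: measurable_fun_rV => i.
rewrite [X in measurable_fun _ X](_ : _ = if i == ord0 then u else v); first by case: ifP.
by apply/funext => x; rewrite mxE; case: ifP.
Qed.

End HalfLine.

(** * Slopes of the integrand in one variable *)

Section SlopeMonotone.
Context {R : realType}.

Lemma MVT_half (f f1 : R -> R) r s : cont_half f ->
  (forall t : R, 0 < t -> is_derive t 1 f (f1 t)) -> 0 <= r -> r < s ->
  exists2 c, r < c < s & f s - f r = f1 c * (s - r).
Proof.
move=> cf df r0 rs.
have [|c] := @MVT _ f f1 r s rs _ (cont_half_within cf r0).
  by move=> x; rewrite in_itv/= => /andP[rx _]; apply: df; exact: le_lt_trans rx.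
by rewrite in_itv/= => cr E; exists c.
Qed.

(* If the slope dropped, the increments near both ends of [r, s] would contradict
   [q (r + d) + q (s - d) <= q r + q s]; this covers the one-sided endpoint [r = 0]. *)
Lemma convex_slope_le (q q1 : R -> R) : cont_half q -> cont_half q1 ->
  (forall t : R, 0 < t -> is_derive t 1 q (q1 t)) ->
  (forall r s t, 0 <= r -> 0 <= s -> 0 <= t <= 1 ->
     q (t * r + (1 - t) * s) <= t * q r + (1 - t) * q s) ->
  forall r s, 0 <= r -> r < s -> q1 r <= q1 s.
Proof.
move=> cq cq1 dq conv r s r0 rs; rewrite leNgt; apply/negP => sr.
have s0 : 0 <= s by lra.
have e0 : 0 < (q1 r - q1 s) / 2 by lra.
have [d1 d10 H1] := cq1 r r0 _ e0; have [d2 d20 H2] := cq1 s s0 _ e0.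
pose d := Num.min (Num.min d1 d2) (s - r).
have d0 : 0 < d by rewrite !lt_min d10 d20 subr_gt0.
have dd1 : d <= d1 by rewrite !ge_min lexx.
have dd2 : d <= d2 by rewrite !ge_min lexx orbT.
have dsr : d <= s - r by rewrite ge_min lexx orbT.
have [c1 /andP[c1r c1d] E1] : exists2 c, r < c < r + d & q (r + d) - q r = q1 c * (r + d - r).
  by apply: (MVT_half cq dq) => //; lra.
have [c2 /andP[c2s c2d] E2] : exists2 c, s - d < c < s & q s - q (s - d) = q1 c * (s - (s - d)).
  by apply: (MVT_half cq dq); lra.
have : `|q1 c1 - q1 r| < (q1 r - q1 s) / 2.
  by apply: H1; [lra|rewrite ltr_norml; apply/andP; split; lra].
have : `|q1 c2 - q1 s| < (q1 r - q1 s) / 2.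
  by apply: H2; [lra|rewrite ltr_norml; apply/andP; split; lra].
rewrite !ltr_norml => /andP[_ A] /andP[B _].
have sr0 : 0 < s - r by lra.
pose t := d / (s - r).
have t01 : 0 <= t <= 1.
  by apply/andP; split; [rewrite divr_ge0 ?ltW|rewrite ler_pdivrMr// mul1r].
have tE : t * (s - r) = d by rewrite divfK// gt_eqF.
have := conv s r t s0 r0 t01; have := conv r s t r0 s0 t01.
have -> : t * r + (1 - t) * s = s - d by rewrite -tE; ring.
have -> : t * s + (1 - t) * r = r + d by rewrite -tE; ring.
move=> Ca Cb; have : q1 c2 < q1 c1 by lra.
have -> : q1 c1 = (q (r + d) - q r) / d by rewrite E1; field; lra.
have -> : q1 c2 = (q s - q (s - d)) / d by rewrite E2; field; lra.
rewrite ltr_pM2r ?invr_gt0//; lra.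
Qed.

(** [g] models a slice of [h] at a fixed second argument and [g1] its derivative; in [conv] the
    contribution of the other [F] has cancelled. *)
Variables (F dF d2F g g1 : R -> R) (eps0 eps : R).
Hypothesis HF : Fhyp F dF d2F.
Hypothesis cg : cont_half g.
Hypothesis cg1 : cont_half g1.
Hypothesis dg : forall r : R, 0 < r -> is_derive r 1 g (g1 r).
Hypothesis g0 : g 0 = 0.
Hypothesis g10 : g1 0 = 0.
Hypothesis eps_gt0 : 0 < eps.
Hypothesis eps_le : eps <= eps0.
Hypothesis conv : forall r s t, 0 <= r -> 0 <= s -> 0 <= t <= 1 ->
  F (t * r + (1 - t) * s) + 2 * eps0 * g (t * r + (1 - t) * s) <=
  t * (F r + 2 * eps0 * g r) + (1 - t) * (F s + 2 * eps0 * g s).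

Lemma Fhyp_cont : cont_half F /\ cont_half dF.
Proof. by have [[_ ? ? _] _ _ _ _] := HF; split; exact: within_cont_half. Qed.

Lemma is_derive_addZ (k t : R) : 0 < t ->
  is_derive t 1 (fun r => F r + k * g r) (dF t + k * g1 t).
Proof.
move=> t0; have [[dF_ _ _ _] _ _ _ _] := HF; have [dFt _] := dF_ t t0.
by apply: is_deriveD; exact: (is_deriveZ k (dg t0)).
Qed.

Lemma cont_addZ k : cont_half (fun r => F r + k * g r) /\ cont_half (fun r => dF r + k * g1 r).
Proof.
by have [cF cdF] := Fhyp_cont; split; apply: cont_halfD => //; exact: cont_halfZ.
Qed.

Lemma perturbed_slope0 : dF 0 + eps * g1 0 = 0.
Proof. by have [_ _ _ [_ ->] _] := HF; rewrite g10 mulr0 addr0. Qed.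

(** Write [2 * eps0 * (dF + eps * g1)] as [(2 * eps0 - eps) * dF + eps * (dF + 2 * eps0 * g1)]: the
    first term is strictly increasing since [eps <= eps0], the second is nondecreasing by
    convexity. *)
Lemma perturbed_slope_incr r s : 0 <= r -> r < s ->
  dF r + eps * g1 r < dF s + eps * g1 s.
Proof.
move=> r0 rs; have [[d2 _ _ _] _ d2F0 _ _] := HF; have [cF cdF] := Fhyp_cont.
have dFlt : dF r < dF s.
  have [c /andP[rc _] E] := @MVT_half dF d2F r s cdF (fun t t0 => (d2 t t0).2) r0 rs.
  have := d2F0 c (le_lt_trans r0 rc); have : 0 < s - r by rewrite subr_gt0.
  by move=> A B; have := mulr_gt0 B A; lra.
have [cq cq1] := cont_addZ (2 * eps0).
have := convex_slope_le cq cq1 (@is_derive_addZ (2 * eps0)) conv r0 rs => qle.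
have e0' : 0 < eps0 by exact: lt_le_trans eps_le.
have e0 : 0 < 2 * eps0 by rewrite mulr_gt0.
rewrite -subr_gt0 -(pmulr_rgt0 _ e0).
have : 0 < (2 * eps0 - eps) * (dF s - dF r) by rewrite mulr_gt0//; have := eps_le; lra.
have : 0 <= eps * (dF s + 2 * eps0 * g1 s - (dF r + 2 * eps0 * g1 r)).
  by rewrite mulr_ge0 ?subr_ge0// ltW.
lra.
Qed.

Lemma perturbed_slope r s : 0 <= r -> 0 <= s ->
  s * (dF r + eps * g1 r) <= (F (r + s) + eps * g (r + s)) - (F r + eps * g r)
    <= s * (dF (r + s) + eps * g1 (r + s)).
Proof.
move=> r0; rewrite le_eqVlt => /predU1P[<-|s0]; first by rewrite addr0 !mul0r subrr lexx.
have [cp cp1] := cont_addZ eps.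
have rrs : r < r + s by rewrite ltrDl.
have [c /andP[rc cs] ->] := MVT_half cp (@is_derive_addZ eps) r0 rrs.
have := perturbed_slope_incr r0 rc.
have := perturbed_slope_incr (ltW (le_lt_trans r0 rc)) cs.
move=> A B; have -> : r + s - r = s by ring.
by rewrite !(mulrC s) !ler_pM2r// !ltW.
Qed.

Lemma perturbed_ge0 r : 0 <= r -> 0 <= F r + eps * g r.
Proof.
move=> r0; have /andP[+ _] := perturbed_slope (lexx 0) r0.
have [_ _ _ [F0 _] _] := HF.
by rewrite perturbed_slope0 mulr0 add0r F0 g0 mulr0 addr0 subr0.
Qed.

End SlopeMonotone.

(** * The energy *)

Section Energy.
Context {R : realType} {n : nat}.
Local Notation mu := (@leb R n).

(** For a nonnegative measurable integrand, failing to be integrable means having infinite integral,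
    so the case distinction in [energy] collapses. *)
Lemma energy_nnint (f : 'rV[R]_n -> R) : measurable_fun setT f -> (forall x, 0 <= f x) ->
  (if pselect (Defs.L1 f) then (Defs.Rint f)%:E else +oo%E) = (\int[mu]_x (f x)%:E)%E.
Proof.
move=> mf f0.
have E1 : (fun x => (`|f x|)%:E) = (fun x => (f x)%:E).
  by apply/funext => x; rewrite ger0_norm.
have E2 : (fun x => (Num.max (f x) 0)%:E) = (fun x => (f x)%:E).
  by apply/funext => x; rewrite max_l.
have E3 : (fun x => (Num.max (- f x) 0)%:E) = (fun x => (0 : R)%:E).
  by apply/funext => x; rewrite max_r// oppr_le0.
have I0 : iint (fun x : 'rV[R]_n => (0 : R)%:E) = 0%E.
  by rewrite iint_EFin//; apply: integral0_eq.
case: pselect => [L|nL] /=.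
  have [_] := L; rewrite E1 /Defs.Rint E2 E3 I0 /= subr0 iint_EFin// => ffin.
  by rewrite fineK// ge0_fin_numE//; exact: nnint_ge0.
apply/esym/eqP; rewrite -leye_eq leNgt; apply/negP => ffin; apply: nL; split.
  exact/borel_funP.
by rewrite E1 iint_EFin.
Qed.

Variables (K : 'rV[R]_n -> R) (a c : R).
Hypotheses (K0 : forall x, 0 <= K x) (Kc : convex_fun K) (a0 : 0 < a) (c0 : 0 <= c).
Hypothesis Kb : forall x, a * sqn x <= K x <= c * sqn x.
Variables P P1 : R -> R -> R.

Definition integrand_ok := [/\
  cont_quad P, cont_quad P1, P 0 0 = 0,
  (forall r1 r2, 0 <= r1 -> 0 <= r2 -> 0 <= P r1 r2) &
  [/\ (forall r2, 0 <= r2 -> P1 0 r2 = 0),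
      (forall r s r2, 0 <= r2 -> 0 <= r -> r < s -> P1 r r2 < P1 s r2) &
      (forall r s r2, 0 <= r2 -> 0 <= r -> 0 <= s ->
         s * P1 r r2 <= P (r + s) r2 - P r r2 <= s * P1 (r + s) r2)]].

Hypothesis HP : integrand_ok.

(** The energy as a single extended-real integral, for an abstract [P] so that the two components
    can later be exchanged. *)
Definition nnenergy (s1 s2 : 'rV[R]_n -> R) : \bar R :=
  (\int[mu]_x (P (s1 x) (s2 x) + s1 x * convol K s2 x)%:E)%E.

Lemma measurable_nnenergy s1 s2 : P2dens s1 -> P2dens s2 ->
  measurable_fun setT (fun x => P (s1 x) (s2 x)) /\
  measurable_fun setT (fun x => s1 x * convol K s2 x).
Proof.
move=> H1 H2; have [cP _ _ _ _] := HP.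
have /P2densP[m1 s10 _ _] := H1; have /P2densP[m2 s20 _ _] := H2.
split; first exact: cont_quad_measurable.
apply: measurable_funM => //; apply: continuous_measurable_rV.
exact: convol_continuous Kb H2.
Qed.

Lemma nnenergy_ge0 s1 s2 : P2dens s1 -> P2dens s2 ->
  (forall x, 0 <= P (s1 x) (s2 x)) /\ (forall x, 0 <= s1 x * convol K s2 x).
Proof.
move=> H1 H2; have [_ _ _ P0 _] := HP.
have /P2densP[m1 s10 _ _] := H1; have /P2densP[m2 s20 _ _] := H2.
split=> x; first exact: P0.
by rewrite mulr_ge0//; exact: convol_ge0 Kb H2 _.
Qed.

(** The uniform density on a unit ball serves as competitor; it forces the minimal energy to be
    finite. *)
Lemma finite_nnenergy : exists2 s, P2dens s & (nnenergy s s < +oo)%E.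
Proof.
pose B : set 'rV[R]_n := ball 0 1; pose v : R := (2 * 1) ^+ n.
have v0 : 0 < v by rewrite exprn_gt0// mulr1.
have v1 : 0 <= v^-1 by rewrite invr_ge0 ltW.
have mB : measurable B by exact: measurable_ball_rV.
have BE : (mu B = v%:E)%E by exact: leb_ball.
have kB k : (k%:E * mu B = (k * v)%:E)%E by rewrite BE -EFinM.
have mI k : measurable_fun setT (fun x => k * (\1_B x : R)).
  by apply: measurable_funM => //; exact: measurable_indic.
pose s (x : 'rV[R]_n) : R := v^-1 * \1_B x.
have s0 x : 0 <= s x by rewrite mulr_ge0// invr_ge0 ltW.
pose S : R := \sum_(i < n) (`|(0 : 'rV[R]_n) ord0 i| + 1) ^+ 2.
have S0 : 0 <= S by apply: sumr_ge0 => i _; exact: sqr_ge0.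
have BS x : B x -> sqn x <= S by move=> Bx; apply: sqn_ball_le.
have Hs : P2dens s.
  apply/P2densP; split => //; first exact: mI.
    by rewrite nnint_indic ?invr_ge0 ?ltW// kB mulVf// gt_eqF.
  apply: (@le_lt_trans _ _ (\int[mu]_x (S * v^-1 * \1_B x)%:E)%E).
    apply: nnint_le => //.
    - by apply: measurable_funM; [exact: measurable_sqn|exact: mI].
    - by move=> x; rewrite mulr_ge0// sqn_ge0.
    - move=> x; rewrite /s mulrA indicE; have [/set_mem Bx|_] := boolP (x \in B).
        by rewrite !mulr1 ler_wpM2r ?invr_ge0 ?BS// ltW.
      by rewrite !mulr0.
  have Sv : 0 <= S * v^-1 by rewrite mulr_ge0// invr_ge0 ltW.
  by rewrite nnint_indic// kB ltry.
exists s => //.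
have [mP mV] := measurable_nnenergy Hs Hs; have [P0 V0] := nnenergy_ge0 Hs Hs.
have [A [D [A0 D0 HV]]] := convol_le K0 Kc c0 Kb Hs.
have [_ _ P00 Pge _] := HP.
pose M := P v^-1 v^-1 + v^-1 * (A * S + D).
have M0 : 0 <= M.
  by rewrite addr_ge0 ?Pge// mulr_ge0// addr_ge0// mulr_ge0.
apply: (@le_lt_trans _ _ (\int[mu]_x (M * \1_B x)%:E)%E).
  apply: nnint_le => //; first exact: measurable_funD.
    by move=> x; rewrite addr_ge0.
  move=> x; have [xB|xB] := boolP (x \in B).
    have -> : s x = v^-1 by rewrite /s indicE xB mulr1.
    rewrite indicE xB mulr1 lerD2l ler_wpM2l//.
    by apply: (le_trans (HV x)); rewrite lerD2r ler_wpM2l// BS//; exact: set_mem.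
  have -> : s x = 0 by rewrite /s indicE (negbTE xB) mulr0.
  by rewrite indicE (negbTE xB) P00 mul0r mulr0 addr0.
by rewrite nnint_indic// kB ltry.
Qed.

Lemma component_minimizer (rho1 rho2 : 'rV[R]_n -> R) : P2dens rho1 -> P2dens rho2 ->
  (nnenergy rho1 rho2 < +oo)%E ->
  (forall s, P2dens s -> (nnenergy rho1 rho2 <= nnenergy s rho2)%E) ->
  exists C, [/\ 0 < C,
    ae_Rd (fun x => P1 (rho1 x) (rho2 x) = Num.max (C - convol K rho2 x) 0),
    supp_dens rho1 = [set x | convol K rho2 x <= C],
    compact (supp_dens rho1) & convex_set_rV (supp_dens rho1)].
Proof.
move=> H1 H2 Efin Emin.
have [cP cP1 _ Pge [P10 P1lt Psl]] := HP.
have /P2densP[m2 s20 _ _] := H2.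
pose p x r := P r (rho2 x); pose p1 x r := P1 r (rho2 x).
have mp (s : 'rV[R]_n -> R) : measurable_fun setT s -> (forall x, 0 <= s x) ->
    measurable_fun setT (fun x => p x (s x)).
  by move=> ms s0; exact: (cont_quad_measurable cP).
have mp1 (s : 'rV[R]_n -> R) : measurable_fun setT s -> (forall x, 0 <= s x) ->
    measurable_fun setT (fun x => p1 x (s x)).
  by move=> ms s0; exact: (cont_quad_measurable cP1).
have p_ge0 x r : 0 <= r -> 0 <= p x r by move=> r0; exact: Pge.
have p1_0 x : p1 x 0 = 0 by exact: P10.
have p1_incr x r s : 0 <= r -> r < s -> p1 x r < p1 x s by exact: P1lt.
have p1_cont x : cont_half (p1 x) by exact: (cont_quad_slice cP1).
have p_slope x r s : 0 <= r -> 0 <= s ->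
  s * p1 x r <= p x (r + s) - p x r <= s * p1 x (r + s) by exact: Psl.
have V0 := convol_ge0 K0 Kc c0 Kb H2.
have Vc := convol_continuous K0 Kc c0 Kb H2.
have Vconv := convol_convex K0 Kc c0 Kb H2.
have Vco := convol_ge K0 Kc a0 c0 Kb H2.
have [C [N [C0 mN N0 EL]]] := @euler_lagrange _ _ p p1 _ rho1 mp mp1 p_ge0 p1_0 p1_incr
  p1_cont p_slope V0 Vc H1 Efin Emin.
have supp := @support_sublevel _ _ p1 _ rho1 p1_0 p1_incr Vc H1 Vconv C N mN N0 EL.
exists C; split => //.
- by exists N; split; [exact: mN|split; [rewrite iint_indic|]].
- by rewrite supp; exact: sublevel_compact.
- by rewrite supp; exact: sublevel_convex.
Qed.

End Energy.

(** * Assembling the two components *)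

Lemma integrand_okP {R : realType} (F dF d2F F' dF' d2F' : R -> R) (h h1 : R -> R -> R)
    (eps0 eps : R) :
  Fhyp F dF d2F -> Fhyp F' dF' d2F' -> cont_quad h -> cont_quad h1 ->
  (forall r1 r2 : R, 0 < r1 -> 0 < r2 -> is_derive r1 1 (fun s => h s r2) (h1 r1 r2)) ->
  (forall r1 r2, 0 <= r1 -> 0 <= r2 -> r1 = 0 \/ r2 = 0 -> h r1 r2 = 0 /\ h1 r1 r2 = 0) ->
  0 < eps <= eps0 ->
  convex_quadrant (fun r1 r2 => F r1 + F' r2 + 2 * eps0 * h r1 r2) ->
  integrand_ok (fun r1 r2 => F r1 + F' r2 + eps * h r1 r2)
               (fun r1 r2 => dF r1 + eps * h1 r1 r2).
Proof.
move=> HF HF' ch ch1 dh h0 /andP[eps_gt0 eps_le] conv.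
have [cF cdF] := Fhyp_cont HF; have [cF' _] := Fhyp_cont HF'.
have [_ _ _ [F0 _] _] := HF; have [_ F'pos _ [F'0 _] _] := HF'.
have hr0 r2 : 0 <= r2 -> h 0 r2 = 0 /\ h1 0 r2 = 0 by move=> ?; apply: h0 => //; left.
(* The derivative is given in the open quadrant only; on the edge [r2 = 0] both [h] and [h1] vanish,
   so the slice is locally the zero function. *)
have dh' r2 : 0 <= r2 -> forall r : R, 0 < r -> is_derive r 1 (fun s => h s r2) (h1 r r2).
  rewrite le_eqVlt => /predU1P[<- r r0|r20 r r0]; last exact: dh.
  have [_ ->] := h0 r 0 (ltW r0) (lexx 0) (or_intror erefl).
  have D : is_derive r 1 (cst (0 : R)) (0 : R) by exact: is_derive_cst.
  apply: near_eq_is_derive D; near=> s.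
  have [] := h0 s 0 _ (lexx 0) (or_intror erefl) => //.
  by near: s; apply: filterS (lt_nbhsr r0) => s /ltW.
have conv' r2 : 0 <= r2 -> forall r s t, 0 <= r -> 0 <= s -> 0 <= t <= 1 ->
    F (t * r + (1 - t) * s) + 2 * eps0 * h (t * r + (1 - t) * s) r2 <=
    t * (F r + 2 * eps0 * h r r2) + (1 - t) * (F s + 2 * eps0 * h s r2).
  move=> r20 r s t r0 s0 t01; have := conv r r2 s r2 t r0 r20 s0 r20 t01.
  have -> : t * r2 + (1 - t) * r2 = r2 by ring.
  lra.
have ch2 r2 : 0 <= r2 -> cont_half (fun r => h r r2) by exact: cont_quad_slice.
have ch12 r2 : 0 <= r2 -> cont_half (fun r => h1 r r2) by exact: cont_quad_slice.
split.
- apply: cont_quadD; last exact: cont_quadZ.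
  apply: cont_quadD; first exact: cont_half_quad.
  exact: (cont_quad_swap (cont_half_quad cF')).
- by apply: cont_quadD; [exact: cont_half_quad|exact: cont_quadZ].
- by have [-> _] := hr0 0 (lexx 0); rewrite F0 F'0 mulr0 !addr0.
- move=> r1 r2 r10 r20; rewrite addrAC addr_ge0 ?F'pos//.
  exact: (perturbed_ge0 HF (ch2 _ r20) (ch12 _ r20) (dh' _ r20) (hr0 _ r20).1
    (hr0 _ r20).2 eps_gt0 eps_le (conv' _ r20)).
- split=> [r2 r20|r s r2 r20 r0 rs|r s r2 r20 r0 s0].
  + exact: (perturbed_slope0 (g1 := fun r => h1 r r2) eps HF (hr0 _ r20).2).
  + exact: (perturbed_slope_incr HF (ch2 _ r20) (ch12 _ r20) (dh' _ r20)
      eps_gt0 eps_le (conv' _ r20)).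
  + have := perturbed_slope HF (ch2 _ r20) (ch12 _ r20) (dh' _ r20)
      eps_gt0 eps_le (conv' _ r20) r0 s0; rewrite /=.
    have -> // : F (r + s) + F' r2 + eps * h (r + s) r2 - (F r + F' r2 + eps * h r r2) =
      F (r + s) + eps * h (r + s) r2 - (F r + eps * h r r2) by ring.
Unshelve. all: by end_near. Qed.

Lemma nnenergy_swap {R : realType} n (K : 'rV[R]_n -> R) (a c : R) (P P1 : R -> R -> R)
    (s1 s2 : 'rV[R]_n -> R) :
  (forall x, 0 <= K x) -> (forall x, K (- x) = K x) -> convex_fun K -> 0 < a -> 0 <= c ->
  (forall x, a * sqn x <= K x <= c * sqn x) -> integrand_ok P P1 ->
  P2dens s1 -> P2dens s2 ->
  nnenergy K P s1 s2 = nnenergy K (fun r1 r2 => P r2 r1) s2 s1.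
Proof.
move=> K0 Ks Kc a0 c0 Kb HP H1 H2.
have [mP mV] := measurable_nnenergy K0 Kc c0 Kb HP H1 H2.
have [P0 V0] := nnenergy_ge0 K0 Kc c0 Kb HP H1 H2.
have /P2densP[m2 s20 _ _] := H2.
rewrite /nnenergy !nnintD//; first by rewrite (interaction_sym K0 Ks Kc a0 c0 Kb H1 H2).
- apply: measurable_funM => //; apply: continuous_measurable_rV.
  exact: convol_continuous Kb H1.
- by move=> x; rewrite mulr_ge0//; exact: convol_ge0 Kb H1 _.
Qed.

Theorem theorem3p8 (R : realType) (d : nat) (hd : (1 <= d)%N)
  (K : 'rV[R]_d -> R)
  (F1 dF1 d2F1 F2 dF2 d2F2 : R -> R)
  (h h1 h2 h1_1 h1_2 h2_1 h2_2 : R -> R -> R)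
  (eps0 eps : R) :
  Khyp K ->
  Fhyp F1 dF1 d2F1 -> Fhyp F2 dF2 d2F2 ->
  hhyp h h1 h2 h1_1 h1_2 h2_1 h2_2 ->
  theta_ok 1 1 dF1 dF2 d2F1 h1_1 -> theta_ok 1 2 dF1 dF2 d2F2 h1_2 ->
  theta_ok 2 1 dF1 dF2 d2F1 h2_1 -> theta_ok 2 2 dF1 dF2 d2F2 h2_2 ->
  0 < eps0 ->
  convex_quadrant (fun r1 r2 => F1 r1 + F2 r2 + 2 * eps0 * h r1 r2) ->
  0 < eps <= eps0 ->
  forall rho1 rho2 : 'rV[R]_d -> R,
  inX0 rho1 rho2 ->
  (forall s1 s2 : 'rV[R]_d -> R, P2dens s1 -> P2dens s2 ->
     (energy K F1 F2 h eps rho1 rho2 <= energy K F1 F2 h eps s1 s2)%E) ->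
  exists C1 C2 : R, [/\ 0 < C1, 0 < C2,
    ae_Rd (fun x => dF1 (rho1 x) + eps * h1 (rho1 x) (rho2 x)
                 = Num.max (C1 - convol K rho2 x) 0),
    ae_Rd (fun x => dF2 (rho2 x) + eps * h2 (rho1 x) (rho2 x)
                 = Num.max (C2 - convol K rho1 x) 0) &
    [/\ supp_dens rho1 = [set x | convol K rho2 x <= C1],
        supp_dens rho2 = [set x | convol K rho1 x <= C2],
        compact (supp_dens rho1) /\ convex_set_rV (supp_dens rho1) &
        compact (supp_dens rho2) /\ convex_set_rV (supp_dens rho2)]].
Proof.
move=> /Khyp_bounds[K0 Ks Kc [a [c [a0 c0 Kb]]]] HF1 HF2 [dh ch h0] _ _ _ _ _ conv eps01.
move=> rho1 rho2 [H1 H2 _] Emin.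
have cq g : g \in [:: h; h1; h2; h1_1; h1_2; h2_1; h2_2] -> cont_quad g.
  by move=> /ch; exact: within_cont_quad.
have [ch0 ch1 ch2] : [/\ cont_quad h, cont_quad h1 & cont_quad h2].
  by split; apply: cq; rewrite !inE eqxx ?orbT.
pose P r1 r2 := F1 r1 + F2 r2 + eps * h r1 r2.
have okP : integrand_ok P (fun r1 r2 => dF1 r1 + eps * h1 r1 r2).
  apply: (integrand_okP HF1 HF2 ch0 ch1 _ _ eps01 conv).
    by move=> r1 r2 r10 r20; have [] := dh r1 r2 r10 r20.
  by move=> r1 r2 r10 r20 r12; have [] := h0 r1 r2 r10 r20 r12.
(* With the arguments exchanged, the second density becomes the varying one, and its slope involves
   [h2] in place of [h1]. *)
have okP' : integrand_ok (fun r1 r2 => P r2 r1) (fun r1 r2 => dF2 r1 + eps * h2 r2 r1).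
  have -> : (fun r1 r2 => P r2 r1) = (fun r1 r2 => F2 r1 + F1 r2 + eps * h r2 r1).
    by apply/funext => r1; apply/funext => r2; rewrite /P (addrC (F1 _)).
  apply: (integrand_okP HF2 HF1 (cont_quad_swap ch0) (cont_quad_swap ch2)) => //.
  - by move=> r1 r2 r10 r20; have [] := dh r2 r1 r20 r10.
  - by move=> r1 r2 r10 r20 r12; have [] := h0 r2 r1 r20 r10 ((or_comm _ _).1 r12).
  - exact: eps01.
  - move=> r1 r2 s1 s2 t r10 r20 s10 s20 t01.
    by have := conv r2 r1 s2 s1 t r20 r10 s20 s10 t01; lra.
have energyE s1 s2 : P2dens s1 -> P2dens s2 ->
    energy K F1 F2 h eps s1 s2 = nnenergy K P s1 s2.
  move=> Hs1 Hs2; have [mP mV] := measurable_nnenergy K0 Kc c0 Kb okP Hs1 Hs2.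
  have [P0 V0] := nnenergy_ge0 K0 Kc c0 Kb okP Hs1 Hs2.
  exact: (energy_nnint (measurable_funD mP mV) (fun x => addr_ge0 (P0 x) (V0 x))).
have Emin' s1 s2 : P2dens s1 -> P2dens s2 -> (nnenergy K P rho1 rho2 <= nnenergy K P s1 s2)%E.
  by move=> Hs1 Hs2; rewrite -!energyE//; exact: Emin.
have Efin : (nnenergy K P rho1 rho2 < +oo)%E.
  have [s Hs] := finite_nnenergy K0 Kc c0 Kb okP.
  by apply: le_lt_trans; exact: Emin'.
have swapE s1 s2 := @nnenergy_swap _ _ _ _ _ _ _ s1 s2 K0 Ks Kc a0 c0 Kb okP.
have [C1 [C10 E1 S1 cpt1 cvx1]] := component_minimizer K0 Kc a0 c0 Kb okP H1 H2 Efin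
  (fun s Hs => Emin' s rho2 Hs H2).
have [||C2 [C20 E2 S2 cpt2 cvx2]] := component_minimizer K0 Kc a0 c0 Kb okP' H2 H1.
- by rewrite -swapE.
- by move=> s Hs; rewrite -!swapE//; exact: Emin'.
by exists C1, C2; split.
Qed.
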